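(* Let $A\in\mathbb C^{n\times n}$ and $b,d\in\mathbb C^n$. Let $\lambda_1,\dots,\lambda_m\in\mathbb C$ be points not lying in $\sigma(A)$, and let $\varkappa_0,\varkappa_1,\dots,\varkappa_m$ and $\chi_0,\chi_1,\dots,\chi_m$ be nonnegative integers. Let $V\in\mathbb C^{n\times\hat n}$ satisfy $V^HV=\mathbf 1_{\hat n\times\hat n}$, and let the following vectors, taken all together, form a basis of the image of $V$: $$A^{i}b\ (0\le i\le\varkappa_0-1),\qquad (A^H)^{i}d\ (0\le i\le\chi_0-1),$$ $$(\lambda_k\mathbf 1-A)^{-j}b\ (1\le k\le m,\ 1\le j\le\varkappa_k),\qquad (\bar\lambda_k\mathbf 1-A^H)^{-j}d\ (1\le k\le m,\ 1\le j\le\chi_k).$$ Put $\widehat A=V^HAV$, $\hat b=V^Hb$, $\hat d=V^Hd$. Let $\sigma(\widehat A)$ consist of the (distinct) points $\hat\mu_1,\dots,\hat\mu_{\hat m}\in\mathbb C$, with algebraic multiplicities $\hat w_1,\dots,\hat w_{\hat m}$, and assume that none of $\lambda_1,\dots,\lambda_m$ belongs to $\sigma(\widehat A)$. Then for every $t\in\mathbb R$ $$\bigl|d^H\exp_t(A)b-\hat d^H\exp_t(\widehat A)\hat b\bigr|\le\max_{\substack{s\in[0,1]\\ \mu\in\operatorname{co}\{\hat\mu_1,\dots,\hat\mu_{\hat m}\}}}\biggl|d^H\Bigl[\Omega(A)[v(A)]^{-1}\frac{(v\exp_t)^{(\hat n)}\bigl((1-s)\mu\mathbf 1+sA\bigr)}{\hat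 n!}\Bigr]b\biggr|,$$ where $$v(\lambda)=\prod_{k=1}^{m}(\lambda-\lambda_k)^{\varkappa_k+\chi_k},\qquad \Omega(\lambda)=\prod_{k=1}^{\hat m}(\lambda-\hat\mu_k)^{\hat w_k}.$$
   Context: $\mathbf 1$ is an identity matrix, $B^H$ is the conjugate transpose, $\sigma(B)$ the spectrum, $\operatorname{co}M$ the convex hull of $M\subset\mathbb C$. $\exp_t(\lambda)=e^{\lambda t}$, and an analytic function $g$ of a matrix $B$ is $g(B)=\frac1{2\pi i}\int_\Gamma g(\lambda)(\lambda\mathbf 1-B)^{-1}d\lambda$ with $\Gamma$ enclosing $\sigma(B)$. $(v\exp_t)^{(\hat n)}$ is the $\hat n$-th derivative in $\lambda$ of $v(\lambda)e^{\lambda t}$. The function $t\mapsto d^H\exp_t(A)b$ is the scalar impulse response of the system $x'=Ax+bu$, $y=d^Hx$, and $t\mapsto\hat d^H\exp_t(\widehat A)\hat b$ is that of the reduced-order system $\hat x'=\widehat A\hat x+\hat bu$, $\hat y=\hat d^H\hat x$. Since the listed vectors form a basis of the image of $V$, $\hat n=\sum_{k=0}^m(\varkappa_k+\chi_k)=\sum_{k=1}^{\hat m}\hat w_k$. *)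

(* Defs.v *)
From HB Require Import structures.
From mathcomp Require Import all_boot all_order all_algebra.
From mathcomp Require Import complex.
From mathcomp Require Import all_classical all_reals all_analysis.

Set Implicit Arguments.
Unset Strict Implicit.
Unset Printing Implicit Defensive.

Import Order.TTheory GRing.Theory Num.Theory.
Import numFieldNormedType.Exports.

Local Open Scope classical_set_scope.
Local Open Scope ring_scope.
Local Open Scope complex_scope.
Local Open Scope sesquilinear_scope.

Section Defs.
Variable R : realType.
Local Notation C := R[i].

Definition cexp (z : C) : C :=
  (expR (complex.Re z))%:C * (cos (complex.Im z) +i* sin (complex.Im z)).

Definition expt (t : R) (z : C) : C := cexp (z * t%:C).

Definition cintegral (a b : R) (f : R -> C) : C :=
  (\int[lebesgue_measure]_(x in `[a, b]) complex.Re (f x))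
  +i* (\int[lebesgue_measure]_(x in `[a, b]) complex.Im (f x)).

(* The integral of h(z) dz over the positively oriented circle |z| = r,
   parametrised by z = r e^(i theta), dz = i z dtheta. *)
Definition circle_integral (r : R) (h : C -> C) : C :=
  cintegral 0 (2 * pi) (fun theta =>
    let z := r%:C * cexp ('i * theta%:C) in h z * ('i * z)).

Definition mxradius n (B : 'M[C]_n) : R :=
  1 + \sum_i \sum_j complex.Re `|B i j|.

Lemma eigenvalue_lt_mxradius n (B : 'M[C]_n) (z : C) :
  eigenvalue B z -> `|z| < (mxradius B)%:C.
Proof.
case/eigenvalueP => v vB vn0.
have [k vk0] : exists k, v 0 k != 0.
  apply/existsP; apply: contra_neqT vn0 => /existsPn v0.
  by apply/rowP => k; rewrite mxE; apply/eqP/negPn.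
pose S := \sum_j `|v 0 j|.
have S0 : 0 < S.
  rewrite /S (bigD1 k)//= ltr_wpDr ?normr_gt0//.
  by apply: sumr_ge0 => *.
have radE : (mxradius B)%:C = 1 + \sum_i \sum_j `|B i j|.
  rewrite /mxradius rmorphD rmorph1 rmorph_sum; congr (_ + _).
  apply: eq_bigr => i _; rewrite rmorph_sum; apply: eq_bigr => j _.
  by apply: RRe_real; exact: normr_real.
rewrite radE -(ltr_pM2r S0).
have le1 : `|z| * S <= \sum_j \sum_i `|v 0 i| * `|B i j|.
  rewrite /S mulr_sumr; apply: ler_sum => j _.
  have := congr1 (fun w : 'rV_n => w 0 j) vB; rewrite !mxE => e.
  rewrite -normrM -e; apply: le_trans (ler_norm_sum _ _ _) _.
  by apply: ler_sum => i _; rewrite normrM.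
have le2 : \sum_j \sum_i `|v 0 i| * `|B i j|
    <= (\sum_i \sum_j `|B i j|) * S.
  rewrite exchange_big/= mulr_suml; apply: ler_sum => i _.
  rewrite -mulr_sumr mulrC; apply: ler_wpM2l.
    by apply: sumr_ge0 => *.
  rewrite /S (bigD1 i)//= lerDl; exact: sumr_ge0.
apply: le_lt_trans (le_trans le1 le2) _.
by rewrite ltr_pM2r// ltrDr.
Qed.

(* The Cauchy integral (1 / 2 pi i) \oint g(z) (z 1 - B)^-1 dz, entry by entry.
   The contour is the circle |z| = mxradius B, which encloses the spectrum of B
   by [eigenvalue_lt_mxradius]; since the disc it bounds is not contained in a
   prescribed domain of g, the definition is meant for entire functions g, for
   which every contour enclosing the spectrum gives the same value. *)
Definition mxfun (g : C -> C) n (B : 'M[C]_n) : 'M[C]_n :=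
  \matrix_(i, j) (((2 * pi)%:C * 'i)^-1 *
    circle_integral (mxradius B) (fun z => g z * invmx (z%:M - B) i j)).

Definition krylov_vectors n m (A : 'M[C]_n) (b d : 'cV[C]_n)
    (lam : 'I_m -> C) (kap0 chi0 : nat) (kap chi : 'I_m -> nat) :
    seq 'cV[C]_n :=
  [seq A ^+ i *m b | i <- iota 0 kap0] ++
  [seq (A^t*) ^+ i *m d | i <- iota 0 chi0] ++
  [seq invmx ((lam k)%:M - A) ^+ j *m b
     | k <- enum 'I_m, j <- iota 1 (kap k)] ++
  [seq invmx (((lam k)^*)%:M - A^t*) ^+ j *m d
     | k <- enum 'I_m, j <- iota 1 (chi k)].

(* [convex_set] over the scalars C restricts its coefficients to elements of C
   in [0, 1], which are real; this is ordinary convexity in the plane. *)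
Definition convex_hull (M : set C) : set C :=
  smallest (@convex_set C C^o) M.

Definition is_max (S : set C) (x : C) := S x /\ ubound S x.

End Defs.

(* Main.v *)
Require Import Defs.
From HB Require Import structures.
From mathcomp Require Import all_boot all_order all_algebra.
From mathcomp Require Import complex ring lra.
From mathcomp Require Import all_classical all_reals all_analysis.

Import Order.TTheory GRing.Theory Num.Theory.
Import numFieldNormedType.Exports.

Local Open Scope classical_set_scope.
Local Open Scope ring_scope.
Local Open Scope complex_scope.
Local Open Scope sesquilinear_scope.

(** Let [T] be a Taylor polynomial of [exp_t] at 0, and [chi] the characteristic
    polynomial of [Ah]. The estimate is first proved with [T] in place of
    [exp_t], where it is a matter of polynomials, and then for [exp_t] by letting
    the degree of [T] grow.

    Moment matching. Split [v = v1 v2] according to the poles of the vectors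
    built from [b] and from [d], and put [u = v1(A)^-1 b], [r = d^H v2(A)^-1].
    The vectors built from [b] are [N1] independent combinations of the [A^j u],
    [j < N1], hence span them all ([rational_krylov_span]); dually for [r] with
    [N2] vectors. So the image of [V] contains enough vectors for
    [r q(A) u] to agree with its reduced analogue whenever
    [deg q < N1 + N2 = nh] ([krylov_moments]). Divide [v T] by [chi]: the
    remainder contributes equally to both responses, and the multiple of [chi]
    vanishes at [Ah]. The error is therefore [r chi(A) q(A) u], where [q] is the
    quotient ([krylov_error], [krylov_reduction_error]).

    Divided differences. That quotient is the divided difference of [v T] at the
    eigenvalues of [Ah]. By the Hermite-Genocchi formula it is an average of the
    values [(v T)^(nh)((1-s) mu + s z) / nh!] with [s] in [0, 1] and [mu] in the
    convex hull of the eigenvalues. The bound that follows from the formula is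
    proved directly, for any linear functional of the quotient, with one
    application of a mean value inequality per node ([divided_difference_le]).

    Passage to the limit. The Cauchy integral defining [mxfun] gives back [p(B)]
    for a polynomial [p] ([mxfun_poly]), and its integrand is controlled by the
    size of [B]; so polynomials converging locally uniformly to [f] give
    matrices converging to [mxfun f B], uniformly over bounded sets of [B]
    ([mxfun_approx]). This applies to [exp_t], and to the derivatives of
    [v exp_t] as well ([poly_approx_derivn]). The same uniformity shows that the
    function to be maximised is continuous on a compact set, so that the maximum
    exists ([sandwich_max]). *)

Set Implicit Arguments.
Unset Strict Implicit.
Unset Printing Implicit Defensive.

(** * Rational Krylov spaces and moment matching *)

Section RationalKrylov.
Variables (F : fieldType) (n : nat).
Implicit Types (A : 'M[F]_n.+1) (u b : 'cV[F]_n.+1).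

Lemma horner_mx_mulmxE A u (q : {poly F}) N : (size q <= N)%N ->
  horner_mx A q *m u = \sum_(j < N) q`_j *: (A ^+ j *m u).
Proof.
move=> qN; rewrite -[in LHS](coefK q) poly_def rmorph_sum mulmx_suml.
rewrite (big_ord_widen N (fun j => horner_mx A (q`_j *: 'X^j) *m u) qN).
rewrite big_mkcond /=; apply: eq_bigr => j _; case: ltnP => [_|qj].
  by rewrite linearZ /= rmorphXn /= horner_mx_X scalemxAl.
by rewrite nth_default // scale0r.
Qed.

Lemma mulmx_horner_mxE (r : 'rV[F]_n.+1) A (q : {poly F}) N : (size q <= N)%N ->
  r *m horner_mx A q = \sum_(j < N) q`_j *: (r *m A ^+ j).
Proof.
move=> qN; rewrite -[in LHS](coefK q) poly_def rmorph_sum mulmx_sumr.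
rewrite (big_ord_widen N (fun j => r *m horner_mx A (q`_j *: 'X^j)) qN).
rewrite big_mkcond /=; apply: eq_bigr => j _; case: ltnP => [_|qj].
  by rewrite linearZ /= rmorphXn /= horner_mx_X scalemxAr.
by rewrite nth_default // scale0r.
Qed.

Definition krylov_family m A b (lam : 'I_m -> F) kap0 (kap : 'I_m -> nat) :=
  [seq A ^+ i *m b | i <- iota 0 kap0] ++
  [seq invmx ((lam k)%:M - A) ^+ j *m b | k <- enum 'I_m, j <- iota 1 (kap k)].

Lemma size_krylov_family m A b (lam : 'I_m -> F) kap0 kap :
  size (krylov_family A b lam kap0 kap) = (kap0 + \sum_k kap k)%N.
Proof.
rewrite size_cat size_map size_iota size_allpairs_dep; congr addn.
by rewrite sumnE big_map big_enum /=; apply: eq_bigr => k _; rewrite size_iota.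
Qed.

Definition pole_poly m (lam : 'I_m -> F) (kap : 'I_m -> nat) : {poly F} :=
  \prod_k ('X - (lam k)%:P) ^+ kap k.

Lemma size_pole_poly m (lam : 'I_m -> F) kap :
  size (pole_poly lam kap) = (\sum_k kap k).+1.
Proof.
rewrite size_prod => [|k _]; last by rewrite expf_neq0 ?polyXsubC_eq0.
under eq_bigr do rewrite size_exp_XsubC -add1n.
by rewrite big_split /= sum1_card -addnS addKn.
Qed.

(** Each Krylov vector is [q(A) u] with [size q <= N], where [N] is their number.
    Being independent, they span the whole space of such vectors, whose
    dimension is at most [N]. This count replaces a partial fraction
    decomposition, and with it any discussion of repeated poles: a pole listed
    twice with positive orders would make the family dependent. *)
Lemma rational_krylov_span m A b (lam : 'I_m -> F) kap0 kap
    (U : {vspace 'cV[F]_n.+1}) u :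
    (forall k, (lam k)%:M - A \in unitmx) ->
    free (krylov_family A b lam kap0 kap) ->
    {subset krylov_family A b lam kap0 kap <= U} ->
    horner_mx A (pole_poly lam kap) *m u = b ->
  forall j, (j < kap0 + \sum_k kap k)%N -> A ^+ j *m u \in U.
Proof.
set X := krylov_family _ _ _ _ _; set N := (kap0 + _)%N => Cu freeX XU ub.
pose Y := [seq A ^+ j *m u | j <- iota 0 N].
have polyY (q : {poly F}) : (size q <= N)%N -> horner_mx A q *m u \in <<Y>>%VS.
  move=> qN; rewrite (horner_mx_mulmxE _ _ qN).
  apply: memv_suml => j _; apply/memvZ/memv_span/map_f.
  by rewrite mem_iota /=.
have XY : (<<X>> <= <<Y>>)%VS.
  apply/span_subvP => x; rewrite mem_cat => /orP[].
    case/mapP => i; rewrite mem_iota /= add0n => ik ->.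
    rewrite -ub mulmxA -[A ^+ i]/(A ^+ i) -{1}(horner_mx_X A) -rmorphXn.
    rewrite -[_ *m horner_mx _ _]rmorphM; apply: polyY.
    rewrite size_monicM ?monicXn ?monic_neq0 //; last first.
      by apply: monic_prod => k _; rewrite monic_exp ?monicXsubC.
    by rewrite size_polyXn size_pole_poly addSn /= addnS ltn_add2r.
  case/allpairsPdep => k [j [_]]; rewrite mem_iota add1n ltnS => /andP[j0 jk] ->.
  (* The sign compensates for the poles entering as lam - A here and as X - lam
     in [pole_poly]. *)
  pose r : {poly F} := ('X - (lam k)%:P) ^+ (kap k - j) *
                        \prod_(l | l != k) ('X - (lam l)%:P) ^+ kap l.
  have qE : pole_poly lam kap = ((lam k)%:P - 'X) ^+ j * (r * (-1) ^+ j).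
    rewrite -(opprB 'X) (exprNn ('X - (lam k)%:P)) [r * _]mulrC mulrACA.
    rewrite -expr2 sqrr_sign mul1r.
    by rewrite /r mulrA -exprD subnKC // /pole_poly (bigD1 k).
  have Ck : (lam k)%:M - A \is a GRing.unit by apply: Cu.
  have CK Q : invmx ((lam k)%:M - A) ^+ j * (((lam k)%:M - A) ^+ j * Q) = Q.
    by rewrite -[invmx _]/(((lam k)%:M - A)^-1) exprVn mulKr ?unitrX.
  have -> : invmx ((lam k)%:M - A) ^+ j *m b = horner_mx A (r * (-1) ^+ j) *m u.
    rewrite -ub qE rmorphM rmorphXn rmorphB /= horner_mx_C horner_mx_X.
    rewrite mulmxA; congr (_ *m u); exact: CK.
  have rm : r \is monic.
    rewrite monicMl ?monic_exp ?monicXsubC ?monic_prod // => l _.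
    by rewrite monic_exp ?monicXsubC.
  apply: polyY; rewrite mulrC size_Msign.
  have := size_pole_poly lam kap.
  rewrite qE -(opprB 'X) (exprNn ('X - (lam k)%:P)) [r * _]mulrC
    -!mulrA size_Msign mulrCA size_Msign.
  rewrite size_monicM ?monic_exp ?monicXsubC ?monic_neq0 // size_exp_XsubC addSn.
  move=> /= sr; have jN : (j + size r <= N.+1)%N by rewrite sr ltnS leq_addl.
  by rewrite -ltnS (leq_trans _ jN) // -[X in (X < _)%N]add0n ltn_add2r.
have dimX : \dim <<X>> = N by rewrite (eqP freeX) size_krylov_family.
have : (<<X>> == <<Y>>)%VS.
  rewrite eqEdim XY dimX /= (leq_trans (dim_span _)) //.
  by rewrite size_map size_iota.
move=> /eqP XeY j jN; apply: (subvP (_ : (<<X>> <= U)%VS)).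
  by apply/span_subvP.
by rewrite XeY; apply/memv_span/map_f; rewrite mem_iota.
Qed.

End RationalKrylov.

Section Moments.
Variables (F : fieldType) (n nh : nat).
Variables (A : 'M[F]_n.+1) (V : 'M[F]_(n.+1, nh.+1)) (W : 'M[F]_(nh.+1, n.+1)).
Let Ah := W *m A *m V.

(** The bound on [j] is one more than in the hypothesis: the last power needs
    [W] on its left only. *)
Lemma krylov_column_moments N (u : 'cV_n.+1) :
  (forall j, (j < N)%N -> V *m W *m (A ^+ j *m u) = A ^+ j *m u) ->
  forall j, (j <= N)%N -> W *m (A ^+ j *m u) = Ah ^+ j *m (W *m u).
Proof.
move=> inV; elim=> [|j IH] jN; first by rewrite !expr0 !mul1mx.
rewrite !exprS -!mulmxA -IH 1?ltnW // -{1}(inV _ jN) /Ah.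
by rewrite !mulmxA.
Qed.

Lemma krylov_row_moments N (r : 'rV_n.+1) :
  (forall j, (j < N)%N -> r *m A ^+ j *m (V *m W) = r *m A ^+ j) ->
  forall j, (j <= N)%N -> r *m A ^+ j *m V = r *m V *m Ah ^+ j.
Proof.
move=> inV; elim=> [|j IH] jN; first by rewrite !expr0 !mulmx1.
rewrite !exprSr -[_ ^+ j * A]/(_ ^+ j *m A) -[_ ^+ j * Ah]/(_ ^+ j *m Ah).
rewrite !mulmxA -IH 1?ltnW // -{1}(inV _ jN) /Ah.
by rewrite !mulmxA.
Qed.

Variables (N1 N2 : nat) (u : 'cV[F]_n.+1) (r : 'rV[F]_n.+1).
Hypothesis colV : forall j, (j < N1)%N -> V *m W *m (A ^+ j *m u) = A ^+ j *m u.
Hypothesis rowV : forall j, (j < N2)%N -> r *m A ^+ j *m (V *m W) = r *m A ^+ j.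

(** Splitting [A ^+ j] into a power absorbed by the column and one absorbed by
    the row; the two ranges of exponents add up. *)
Lemma krylov_moments j : (j < N1 + N2)%N ->
  r *m (A ^+ j *m u) = r *m V *m (Ah ^+ j *m (W *m u)).
Proof.
move=> jN; have [jN1|N1j] := ltnP j N1.
  by rewrite -(krylov_column_moments colV) 1?ltnW // -{1}colV // !mulmxA.
rewrite -(subnK N1j) !exprD -[_ * A ^+ _]/(_ *m A ^+ _) -[_ * Ah ^+ _]/(_ *m Ah ^+ _).
rewrite -!mulmxA -(krylov_column_moments colV) // !mulmxA.
have jN2 : (j - N1 < N2)%N by rewrite ltn_subLR.
by rewrite -(krylov_row_moments rowV) 1?ltnW // -(mulmxA _ V) rowV.
Qed.

Lemma krylov_moments_poly (q : {poly F}) : (size q <= N1 + N2)%N ->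
  r *m (horner_mx A q *m u) = r *m V *m (horner_mx Ah q *m (W *m u)).
Proof.
move=> qN; rewrite !(horner_mx_mulmxE _ _ qN) !mulmx_sumr.
apply: eq_bigr => j _; rewrite -!scalemxAr; congr (_ *: _).
exact: krylov_moments.
Qed.

(** Dividing [v2 * v1 * T] by the characteristic polynomial of [Ah] isolates the
    error: the remainder is short enough for its moments to match, and the
    multiple of [char_poly Ah] vanishes at [Ah] by Cayley-Hamilton. *)
Lemma krylov_error (v1 v2 T : {poly F}) :
  nh.+1 = (N1 + N2)%N -> (size v1 <= N1.+1)%N -> (size v2 <= N2.+1)%N ->
  (r *m horner_mx A v2) *m (horner_mx A T *m (horner_mx A v1 *m u)) -
  (r *m horner_mx A v2 *m V) *m (horner_mx Ah T *m (W *m (horner_mx A v1 *m u)))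
  = r *m (horner_mx A (char_poly Ah) *m
       (horner_mx A ((v2 * v1 * T) %/ char_poly Ah) *m u)).
Proof.
move=> nhE s1 s2.
have colE : W *m (horner_mx A v1 *m u) = horner_mx Ah v1 *m (W *m u).
  rewrite !(horner_mx_mulmxE _ _ s1) mulmx_sumr.
  apply: eq_bigr => j _; rewrite -scalemxAr (krylov_column_moments colV) //.
  by rewrite -ltnS.
have rowE : r *m horner_mx A v2 *m V = r *m V *m horner_mx Ah v2.
  rewrite !(mulmx_horner_mxE _ _ s2) mulmx_suml.
  apply: eq_bigr => j _; rewrite -scalemxAl (krylov_row_moments rowV) //.
  by rewrite -ltnS.
rewrite colE rowE; set p := v2 * v1 * T.
have -> : r *m horner_mx A v2 *m (horner_mx A T *m (horner_mx A v1 *m u))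
   = r *m (horner_mx A p *m u).
  by rewrite /p mulrAC !rmorphM /= -!mulmxA.
have -> : r *m V *m horner_mx Ah v2 *m (horner_mx Ah T *m (horner_mx Ah v1 *m (W *m u)))
   = r *m V *m (horner_mx Ah p *m (W *m u)).
  by rewrite /p mulrAC !rmorphM /= -!mulmxA.
have {1 2}-> := divp_eq p (char_poly Ah).
rewrite !rmorphD !rmorphM /= Cayley_Hamilton mulr0 add0r.
rewrite -krylov_moments_poly; last first.
  rewrite -ltnS -nhE -(size_char_poly Ah) ltn_modp monic_neq0 //.
  exact: char_poly_monic.
rewrite mulmxDl mulmxDr addrK; congr (_ *m _).
by rewrite mulmxA -[_ *m horner_mx A (p %/ _)]rmorphM /= mulrC rmorphM.
Qed.

End Moments.

(** * Complex-valued functions of a real variable *)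

Section RealVariable.
Variable R : realType.
Local Notation C := R[i].
Local Notation re := (@complex.Re R).
Local Notation im := (@complex.Im R).
Implicit Types (f g : R -> C) (z : C).

Lemma ReD z w : re (z + w) = re z + re w.
Proof. by case: z w => ? ? [? ?]. Qed.

Lemma ImD z w : im (z + w) = im z + im w.
Proof. by case: z w => ? ? [? ?]. Qed.

Lemma ReM z w : re (z * w) = re z * re w - im z * im w.
Proof. by case: z w => ? ? [? ?]. Qed.

Lemma ImM z w : im (z * w) = re z * im w + im z * re w.
Proof. by case: z w => ? ? [? ?]. Qed.

Lemma normc_real (s : R) : `|s%:C| = `|s|%:C :> C.
Proof. by rewrite normc_def /= expr0n addr0 sqrtr_sqr. Qed.

Lemma normci : `|'i| = 1 :> C.
Proof. by rewrite normc_def /= expr0n expr1n add0r sqrtr1. Qed.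

Lemma norm_is_real z : exists r : R, `|z| = r%:C.
Proof. by exists (re `|z|); rewrite RRe_real ?normr_real. Qed.

Lemma Re_le_norm z : (re z)%:C <= `|z|.
Proof. by apply: le_trans (normc_ge_Re z); rewrite lecR ler_norm. Qed.

(** Componentwise, because differentiation in the normed space [R[i]^o] is with
    respect to a complex variable. *)
Definition cderive f f' := forall x : R,
  is_derive x 1 (re \o f) (re (f' x)) /\
  is_derive x 1 (im \o f) (im (f' x)).

Lemma cderive_eq f f' g' : cderive f f' -> f' =1 g' -> cderive f g'.
Proof. by move=> df e x; rewrite -e. Qed.

Lemma cderive_cst z : cderive (fun=> z) (fun=> 0).
Proof. by move=> x; split; apply: is_derive_cst. Qed.

Lemma cderive_id : cderive (fun x => x%:C) (fun=> 1).
Proof. by move=> x; split; [apply: is_derive_id|apply: is_derive_cst]. Qed.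

Lemma cderiveD f f' g g' : cderive f f' -> cderive g g' ->
  cderive (fun x => f x + g x) (fun x => f' x + g' x).
Proof.
move=> df dg x; rewrite ReD ImD; have [f1 f2] := df x; have [g1 g2] := dg x.
split.
  rewrite (_ : _ \o _ = (re \o f) + (re \o g)); last first.
    by apply/funext => y /=; rewrite ReD.
  exact: is_deriveD.
rewrite (_ : _ \o _ = (im \o f) + (im \o g)); last first.
  by apply/funext => y /=; rewrite ImD.
exact: is_deriveD.
Qed.

Lemma cderiveM f f' g g' : cderive f f' -> cderive g g' ->
  cderive (fun x => f x * g x) (fun x => f' x * g x + f x * g' x).
Proof.
move=> df dg x; have [f1 f2] := df x; have [g1 g2] := dg x; split.
  rewrite (_ : _ \o _ = (re \o f) * (re \o g) - (im \o f) * (im \o g)); last first.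
    by apply/funext => y /=; rewrite ReM.
  by apply: is_derive_eq; rewrite ReD !ReM /= /GRing.scale /=; ring.
rewrite (_ : _ \o _ = (re \o f) * (im \o g) + (im \o f) * (re \o g)); last first.
  by apply/funext => y /=; rewrite ImM.
by apply: is_derive_eq; rewrite ImD !ImM /= /GRing.scale /=; ring.
Qed.

Lemma cderive_horner (p : {poly C}) :
  cderive (fun x => p.[x%:C]) (fun x => p^`().[x%:C]).
Proof.
elim/poly_ind: p => [|p c ih].
  have -> : (fun x : R => (0 : {poly C}).[x%:C]) = (fun=> 0).
    by apply/funext => x; rewrite horner0.
  by apply: cderive_eq (cderive_cst 0) _ => x; rewrite deriv0 horner0.
have -> : (fun x : R => (p * 'X + c%:P).[x%:C]) = (fun x => p.[x%:C] * x%:C + c).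
  by apply/funext => x; rewrite !hornerE.
apply: cderive_eq (cderiveD (cderiveM ih cderive_id) (cderive_cst c)) _ => x /=.
by rewrite derivD derivM derivX derivC !hornerE.
Qed.

(** Rotating the increment of [f] onto the positive real axis by a unit factor
    [u] reduces the claim to the mean value theorem for the real function
    [Re (u f(x)) - c x^(K+1)]. The weight [x^K] is what makes the factorials of
    iterated integrals come out when the lemma is used inside an induction. *)
Lemma mean_value_le f f' (c : R) K : cderive f f' ->
    (forall x, 0 <= x <= 1 -> `|f' x| <= (c * K.+1%:R * x ^+ K)%:C) ->
  `|f 1 - f 0| <= c%:C.
Proof.
move=> df f'c; set w := f 1 - f 0.
have c0 : 0 <= c.
  have := le_trans (normr_ge0 _) (f'c 1 _); rewrite ler01 lexx expr1n mulr1 ler0c.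
  by rewrite pmulr_lge0 // => ->.
have [w0|w0] := eqVneq w 0; first by rewrite w0 normr0 ler0c.
pose u : C := `|w| / w.
have u1 : `|u| = 1 by rewrite normf_div normr_id divff // normr_eq0.
have uw : u * w = `|w| by rewrite divfK.
pose g (x : R) : R := re (u * f x) - c * x ^+ K.+1.
have dg (x : R) : is_derive x (1 : R) g (re (u * f' x) - c * (K.+1%:R * x ^+ K)).
  have [d1 _] := cderiveM (cderive_cst u) df x.
  have d2 : is_derive x (1 : R) (re \o (fun y => u * f y)) (re (u * f' x)).
    by apply: is_derive_eq d1 _; rewrite mul0r add0r.
  rewrite (_ : g = (re \o (fun y => u * f y)) -
                   horner (c *: 'X^(K.+1))); last first.
    by apply/funext => y; rewrite /g /= !fctE !hornerE.
  apply: is_derive_eq; rewrite derivZ derivXn !hornerE /=.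
  by rewrite hornerMn hornerXn -mulrA mulr_natl.
have [|y y01] := @MVT R g _ 0 1 ltr01 (fun x _ => dg x).
  apply: derivable_within_continuous => x _; exact: (@ex_derive _ _ _ _ _ _ _ (dg x)).
rewrite subr0 mulr1 => gE.
have : g 1 - g 0 <= 0.
  rewrite gE subr_le0 mulrA -lecR (le_trans (Re_le_norm _)) // normrM u1 mul1r.
  by apply: f'c; move: y01; rewrite in_itv /= => /andP[/ltW -> /ltW ->].
rewrite /g expr1n expr0n /= mulr1 mulr0 subr0 => h.
have {h}: re (u * f 1) - re (u * f 0) <= c by move: h; lra.
have -> : re (u * f 1) - re (u * f 0) = re (u * w).
  by rewrite /w mulrBr ReD; case: (u * f 0).
by rewrite uw -lecR RRe_real ?normr_real.
Qed.

End RealVariable.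

(** * Divided differences *)

Section DividedDifference.
Variable R : realType.
Local Notation C := R[i].

(** The map [z |-> (1 - s) a + s z], as a polynomial to compose with. *)
Definition homothety (a : C) (s : R) : {poly C} :=
  ((1 - s%:C) * a)%:P + s%:C *: 'X.

Lemma derivn_comp_homothety N (p : {poly C}) a s :
  (p \Po homothety a s)^`(N) = s%:C ^+ N *: (p^`(N) \Po homothety a s).
Proof.
elim: N => [|N IH]; first by rewrite !derivn0 expr0 scale1r.
rewrite !derivnS IH derivZ deriv_comp /homothety derivD derivC derivZ derivX add0r.
by rewrite -scalerAr mulr1 scalerA exprSr.
Qed.

Lemma homothety_comp (a b m : C) (s x : R) :
  (1 - (x * s)%:C) * m = (1 - x%:C) * b + x%:C * (1 - s%:C) * a ->
  homothety b x \Po homothety a s = homothety m (x * s).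
Proof.
move=> e; rewrite /homothety comp_polyD comp_polyC comp_polyZ comp_polyX e.
rewrite scalerDr scalerA [(x * s)%:C]rmorphM addrA polyCD; congr (_ + _ + _).
by rewrite -mulrA (polyCM x%:C) mul_polyC.
Qed.

(** The composite has ratio [x * s] and fixes a weighted mean of the two centres;
    when the ratio is 1 both maps are the identity and any centre will do. *)
Lemma homothety_comp_convex (K : set C) a b (s x : R) :
    (forall y z (t : R), 0 <= t <= 1 -> K y -> K z ->
       K ((1 - t%:C) * y + t%:C * z)) ->
    K a -> K b -> 0 <= s <= 1 -> 0 <= x <= 1 ->
  exists2 m, K m & homothety b x \Po homothety a s = homothety m (x * s).
Proof.
move=> convK Ka Kb /andP[s0 s1] /andP[x0 x1].
have [xs1|xs1] := eqVneq (x * s) 1.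
  exists a => //; apply: homothety_comp.
  have -> : s = 1.
    by apply/le_anti; rewrite s1 /= -xs1 ler_piMl.
  have -> : x = 1.
    by apply/le_anti; rewrite x1 /= -xs1 ler_piMr.
  by rewrite !mulr1 !subrr mulr0 !mul0r addr0.
have xsE : 0 < 1 - x * s.
  by rewrite subr_gt0 lt_neqAle xs1 /= mulr_ile1.
pose t := x * (1 - s) / (1 - x * s).
exists ((1 - t%:C) * b + t%:C * a).
  apply: convK => //; apply/andP; split.
    by rewrite divr_ge0 ?(ltW xsE) // mulr_ge0 // subr_ge0.
  by rewrite ler_pdivrMr // mul1r; lra.
have tE : (1 - x * s) * t = x * (1 - s) by rewrite /t mulrC divfK // gt_eqF.
have tC : (1 - (x * s)%:C) * t%:C = x%:C * (1 - s%:C).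
  have -> : 1 - (x * s)%:C = (1 - x * s)%:C by rewrite rmorphB rmorph1.
  by rewrite -rmorphM tE rmorphM rmorphB rmorph1.
apply: homothety_comp; rewrite mulrDr !mulrA mulrBr mulr1 tC.
by congr (_ * _ + _); rewrite rmorphM /=; ring.
Qed.

(** Differentiating [p(a + x (X - a))] in [x] produces a factor [X - a], which
    cancels the node [a] of the divided difference. By linearity this is a check
    on the powers of [X - a]. *)
Lemma cderive_quotient (Psi : {linear {poly C} -> C^o}) (p P : {poly C}) a :
  P != 0 ->
  cderive (fun x => Psi ((p \Po homothety a x) %/ (('X - a%:P) * P)))
          (fun x => Psi ((p^`() \Po homothety a x) %/ P)).
Proof.
move=> P0; have Xa0 : 'X - a%:P != 0 by rewrite polyXsubC_eq0.
have -> : p = \sum_(i < size (p \Po ('X + a%:P)))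
    (p \Po ('X + a%:P))`_i *: ('X - a%:P) ^+ i.
  rewrite -comp_polyE -comp_polyA comp_polyD comp_polyX comp_polyC subrK.
  by rewrite comp_polyXr.
elim/big_ind: _ => [|q r dq dr|i _].
- have -> : (fun x => Psi ((0 \Po homothety a x) %/ (('X - a%:P) * P))) = (fun=> 0).
    by apply/funext => x; rewrite comp_poly0 div0p linear0.
  by apply: cderive_eq (cderive_cst 0) _ => x; rewrite deriv0 comp_poly0 div0p linear0.
- have -> : (fun x => Psi (((q + r) \Po homothety a x) %/ (('X - a%:P) * P))) =
    (fun x => Psi ((q \Po homothety a x) %/ (('X - a%:P) * P)) +
              Psi ((r \Po homothety a x) %/ (('X - a%:P) * P))).
    by apply/funext => x; rewrite comp_polyD divpD linearD.
  apply: cderive_eq (cderiveD dq dr) _ => x /=.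
  by rewrite derivD comp_polyD divpD linearD.
have hX x : ('X - a%:P) \Po homothety a x = x%:C *: ('X - a%:P).
  rewrite comp_polyB comp_polyX comp_polyC /homothety.
  by rewrite scalerBr mulrBl mul1r polyCB polyCM mul_polyC; ring.
have hXn x j : (('X - a%:P) ^+ j) \Po homothety a x = x%:C ^+ j *: ('X - a%:P) ^+ j.
  by rewrite rmorphXn /= hX exprZn.
case: i => [[|i] /= iq].
  have -> : (fun x => Psi (((p \Po ('X + a%:P))`_0 *: ('X - a%:P) ^+ 0 \Po homothety a x)
      %/ (('X - a%:P) * P))) = (fun=> 0).
    apply/funext => x; rewrite expr0 comp_polyZ rmorph1 divpZl divp_small ?scaler0 ?linear0 //.
    by rewrite size_poly1 size_mul // size_XsubC !addSn ltnS size_poly_gt0.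
  apply: cderive_eq (cderive_cst 0) _ => x.
  by rewrite expr0 derivZ derivC scaler0 comp_poly0 div0p linear0.
set c := _`_i.+1.
pose k := c * Psi (('X - a%:P) ^+ i %/ P).
have -> : (fun x => Psi ((c *: ('X - a%:P) ^+ i.+1 \Po homothety a x)
      %/ (('X - a%:P) * P))) = (fun x => (k *: 'X^(i.+1)).[x%:C]).
  apply/funext => x; rewrite comp_polyZ hXn scalerA divpZl linearZ /= (exprS ('X - a%:P)).
  by rewrite divp_pmul2l // hornerZ hornerXn /k mulrAC.
apply: cderive_eq (cderive_horner _) _ => x.
rewrite !derivZ derivXn deriv_exp derivB derivX derivC subr0 mul1r.
rewrite /= -['X^i *+ _]scaler_nat -[('X - a%:P) ^+ i *+ _]scaler_nat.
rewrite !comp_polyZ hXn !divpZl !linearZ /= !hornerZ hornerXn /k.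
by set y := Psi _; rewrite /GRing.scale /=; move: (y : C) => z; ring.
Qed.

(** The quotient of [p] by the product of the [X - m] is the divided difference
    of [p] at the nodes [mus] and a free node [X]. The Hermite-Genocchi formula
    writes it as an average of the values bounded in the hypothesis, divided by
    a factorial. Removing one node [a] at a time, the quotient is the increment
    over [0, 1] of its analogue for [p] shrunk towards [a], whose derivative has
    one node less ([cderive_quotient]); the mean value inequality then replaces
    the multiple integral. As [Psi] is any linear functional, the bound applies
    at once to the polynomial evaluated at a matrix. *)
Lemma divided_difference_le (Psi : {linear {poly C} -> C^o}) (K : set C)
    (mus : seq C) (p : {poly C}) (M : R) :
    (forall y z (t : R), 0 <= t <= 1 -> K y -> K z ->
       K ((1 - t%:C) * y + t%:C * z)) ->
    (exists m, K m) -> (forall m, m \in mus -> K m) ->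
    (forall (s : R) m, 0 <= s <= 1 -> K m ->
       `|Psi (p^`(size mus) \Po homothety m s) : C| <= M%:C) ->
  `|Psi (p %/ \prod_(m <- mus) ('X - m%:P)) : C| <= (M / (size mus)`!%:R)%:C.
Proof.
move=> convK [m0 Km0]; elim: mus p M => [|a mus IH] p M Kmus pM.
  have := pM 1 m0; rewrite ler01 lexx => /(_ isT Km0).
  rewrite big_nil divp1 /homothety rmorph1 subrr mul0r polyC0 add0r scale1r.
  by rewrite comp_polyXr fact0 divr1.
have Ka : K a by apply: Kmus; rewrite mem_head.
rewrite big_cons; set P := \prod_(_ <- _) _.
have P0 : P != 0 by rewrite monic_neq0 // monic_prod => // m _; apply: monicXsubC.
pose L x := Psi ((p \Po homothety a x) %/ (('X - a%:P) * P)).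
have -> : Psi (p %/ (('X - a%:P) * P)) = L 1 - L 0.
  rewrite /L /homothety rmorph1 rmorph0 !subrr subr0 mul0r mul1r polyC0 add0r.
  rewrite scale1r scale0r addr0 comp_polyXr comp_polyCr.
  rewrite [X in _ - Psi X]divp_small ?linear0 ?oppr0 ?addr0 //.
  rewrite size_mul ?polyXsubC_eq0 //.
  by rewrite size_XsubC !addSn ltnS (leq_trans (size_polyC_leq1 _)) ?size_poly_gt0.
apply: (@mean_value_le R _ _ _ (size mus) (cderive_quotient Psi p a P0)) => x x01.
rewrite factS natrM invfM !mulrA.
have -> : M / (size mus).+1%:R / (size mus)`!%:R * (size mus).+1%:R * x ^+ size mus
  = x ^+ size mus * M / (size mus)`!%:R.
  have f0 : (size mus)`!%:R != 0 :> R by rewrite pnatr_eq0 -lt0n fact_gt0.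
  have n0 : (size mus).+1%:R != 0 :> R by rewrite pnatr_eq0.
  by move: n0 f0; set u := _.+1%:R; set w := _`!%:R => n0 f0; field; apply/andP.
apply: IH => [m mm|s m s01 Km]; first by apply: Kmus; rewrite inE mm orbT.
(* The derivative of order [size mus] of [p^`() \Po homothety a x] carries the
   factor x ^+ size mus required by the mean value inequality. *)
rewrite derivn_comp_homothety -derivSn comp_polyZ linearZ /GRing.scale /= normrM rmorphM.
apply: ler_pM => //.
  by rewrite normrX ger0_norm ?rmorphXn //= ler0c; case/andP: x01.
have [m' Km' e] := homothety_comp_convex convK Km Ka s01 x01.
rewrite -comp_polyA e; apply: pM => //.
case/andP: x01 => ? ?; case/andP: s01 => ? ?.
by rewrite mulr_ge0 // mulr_ile1.
Qed.

End DividedDifference.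

(** * The complex exponential *)

Section ComplexExponential.
Variable R : realType.
Local Notation C := R[i].
Local Notation re := (@complex.Re R).
Local Notation im := (@complex.Im R).

Lemma cexpD (z w : C) : cexp (z + w) = cexp z * cexp w.
Proof.
rewrite /cexp ReD ImD expRD cosD sinD rmorphM mulrACA; congr (_ * _).
by apply/eqP; rewrite eq_complex /= eqxx [X in _ && (X == _)]addrC mulrC eqxx.
Qed.

Lemma cexp0 : cexp 0 = 1 :> C.
Proof. by rewrite /cexp expR0 cos0 sin0 mul1r. Qed.

Lemma norm_cexp (z : C) : `|cexp z| = (expR (re z))%:C.
Proof.
rewrite /cexp normrM [X in _ * X]normc_def /= cos2Dsin2 sqrtr1 mulr1.
by rewrite ger0_norm // ler0c expR_ge0.
Qed.

Lemma cderive_cexp_line (z : C) :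
  cderive (fun s => cexp (z * s%:C)) (fun s => z * cexp (z * s%:C)).
Proof.
have dline (a : R) s : is_derive s (1 : R) ( *%R a) a.
  rewrite (_ : *%R a = horner (a *: 'X)); last by apply/funext => y; rewrite !hornerE.
  by apply: is_derive_eq; rewrite derivZ derivX !hornerE.
case: z => a b.
have -> : (fun s : R => cexp ((a +i* b) * s%:C)) =
  fun s => (expR (a * s) * cos (b * s)) +i* (expR (a * s) * sin (b * s)).
  apply/funext => s; rewrite /cexp ReM ImM /= !mulr0 subr0 add0r.
  by apply/eqP; rewrite eq_complex /= !mul0r subr0 addr0 !eqxx.
have e s : is_derive s (1 : R) (expR \o *%R a) (expR (a * s) * a).
  exact: is_derive1_comp.
have c s : is_derive s (1 : R) (@cos R \o *%R b) (- sin (b * s) * b).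
  exact: is_derive1_comp.
have d s : is_derive s (1 : R) (@sin R \o *%R b) (cos (b * s) * b).
  exact: is_derive1_comp.
move=> s; split.
  rewrite (_ : _ \o _ = (expR \o *%R a) * (@cos R \o *%R b)); last by apply/funext.
  apply: is_derive_eq; rewrite ReM /cexp !ReM !ImM /= /GRing.scale /=.
  by rewrite !mulr0 !mul0r !subr0 !addr0 !add0r; ring.
rewrite (_ : _ \o _ = (expR \o *%R a) * (@sin R \o *%R b)); last by apply/funext.
apply: is_derive_eq; rewrite ImM /cexp !ReM !ImM /= /GRing.scale /=.
by rewrite !mulr0 !mul0r !subr0 !addr0 !add0r; ring.
Qed.

Definition exp_poly K : {poly C} := \poly_(k < K) (k`!%:R)^-1.

Lemma deriv_exp_poly K : (exp_poly K)^`() = exp_poly K.-1.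
Proof.
apply/polyP => i; rewrite coef_deriv !coef_poly; case: K => [|K] /=.
  by rewrite mul0rn.
rewrite ltnS; case: ifP => _; last by rewrite mul0rn.
by rewrite factS natrM invfM -mulrnAl -[_ *+ _]mulr_natr mulVf ?mul1r.
Qed.

(** Along the segment from 0 to [z] the remainder of order [K+1] has [z] times
    the remainder of order [K] as derivative, so the mean value inequality gives
    the bound by induction on [K]. *)
Lemma cexp_remainder (rho : R) K (z : C) : `|z| <= rho%:C ->
  `|cexp z - (exp_poly K).[z]| <= (exp_coeff rho K * expR rho)%:C.
Proof.
have rho0 r (w : C) : `|w| <= r%:C -> 0 <= r :> R.
  by move=> h; rewrite -ler0c (le_trans _ h).
rewrite /exp_coeff /=.
elim: K rho z => [|K IH] rho z zr; have r0 := rho0 _ _ zr.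
  rewrite /exp_poly poly_def big_ord0 horner0 subr0 expr0 fact0 invr1 !mul1r.
  by rewrite norm_cexp lecR ler_expR -lecR (le_trans (Re_le_norm z)).
pose f s := cexp (z * s%:C) + - ((exp_poly K.+1) \Po (z *: 'X)).[s%:C].
have df : cderive f (fun s => z * (cexp (z * s%:C) - (exp_poly K).[z * s%:C])).
  have dp : cderive (fun s => - ((exp_poly K.+1) \Po (z *: 'X)).[s%:C])
    (fun s => - (z * (exp_poly K).[z * s%:C])).
    have -> : (fun s : R => - ((exp_poly K.+1) \Po (z *: 'X)).[s%:C]) =
              (fun s => (- ((exp_poly K.+1) \Po (z *: 'X))).[s%:C]).
      by apply/funext => s; rewrite hornerN.
    apply: (cderive_eq (cderive_horner _)) => s.
    rewrite derivN deriv_comp deriv_exp_poly /= derivZ derivX hornerN hornerM.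
    by rewrite horner_comp alg_polyC hornerC hornerZ hornerX mulrC.
  apply: cderive_eq (cderiveD (cderive_cexp_line z) dp) _ => s /=.
  by rewrite mulrBr.
have -> : cexp z - (exp_poly K.+1).[z] = f 1 - f 0.
  rewrite /f !horner_comp !hornerZ !hornerX rmorph1 rmorph0 mulr0 mulr1 cexp0.
  rewrite [(exp_poly _).[0]]horner_coef0 coef_poly /= fact0 invr1 subrr.
  by rewrite subr0.
apply: (@mean_value_le R _ _ _ K df) => s /andP[s0 s1].
have zs : `|z * s%:C| <= (s * rho)%:C.
  rewrite normrM mulrC rmorphM ler_pM //= ?normr_ge0 //.
  by rewrite ger0_norm ?ler0c.
rewrite normrM (le_trans (ler_pM (normr_ge0 _) (normr_ge0 _) zr (IH _ _ zs))) //.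
rewrite -rmorphM lecR factS natrM invfM exprMn exprS.
have -> : rho * rho ^+ K * (K.+1%:R^-1 / K`!%:R) * expR rho * K.+1%:R * s ^+ K
   = rho * (s ^+ K * rho ^+ K / K`!%:R * expR rho).
  have n0 : K.+1%:R != 0 :> R by rewrite pnatr_eq0.
  by rewrite -[LHS](mulfVK n0) -[RHS](mulfVK n0); congr (_ * _); set u := _.+1%:R;
     move: (rho ^+ K) (K`!%:R^-1 : R) => x y; field.
rewrite ler_wpM2l // ler_wpM2l ?ler_expR ?ler_piMl //.
by rewrite divr_ge0 ?mulr_ge0 ?exprn_ge0.
Qed.

End ComplexExponential.

Section ComplexDerivative.
Variable R : realType.
Local Notation C := R[i].

(** The increment differs from its linear part by the remainder of
    [cexp_remainder] at order 2, which is quadratic in [h]. *)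
Lemma is_derive_expt (t : R) (z : C) :
  is_derive (z : C^o) (1 : C^o) (expt t : C^o -> C^o) (t%:C * expt t z).
Proof.
pose M : C := `|expt t z| * (`|t| ^+ 2 * expR `|t|)%:C + 1.
have M0 : 0 < M.
  by rewrite ltr_wpDl // mulr_ge0 // ler0c mulr_ge0 ?expR_ge0 ?sqr_ge0.
suff cv : (fun h : C^o => h^-1 *: (((expt t : C^o -> C^o) \o shift (z : C^o))
    (h *: (1 : C^o)) - expt t z)) @ 0^' --> (t%:C * expt t z : C^o).
  by apply: DeriveDef; [apply/cvg_ex; exists (t%:C * expt t z) | apply: cvg_lim].
apply/cvgrPdist_le => /= e e0.
near=> h.
have h0 : h != 0 by near: h; apply: nbhs_dnbhs_neq.
have h1 : `|h| <= 1 by near: h; apply: dnbhs0_le.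
have he : `|h| <= e / M by near: h; apply: dnbhs0_le; rewrite divr_gt0.
have -> : expt t (h *: 1 + z) = cexp (h * t%:C) * expt t z.
  by rewrite /expt -cexpD -[h *: 1]/(h * 1) mulr1 mulrDl.
have -> : t%:C * expt t z - h^-1 *: (cexp (h * t%:C) * expt t z - expt t z)
   = - (h^-1 * (cexp (h * t%:C) - (exp_poly R 2).[h * t%:C]) * expt t z).
  rewrite /exp_poly poly_def !big_ord_recl big_ord0 /= addr0 expr0 expr1.
  rewrite !fact0 invr1 !scale1r hornerD hornerC hornerX -[h^-1 *: _]/(h^-1 * _).
  by field.
rewrite normrN normrM normrM normfV.
have [r rE] := norm_is_real (h : C).
have ht : `|h * t%:C| <= (r * `|t|)%:C.
  by rewrite normrM rE normc_real rmorphM.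
have := cexp_remainder 2 ht; rewrite /exp_coeff /=.
set N := `|cexp _ - _| => hN.
have hN2 : N <= `|h| ^+ 2 * (`|t| ^+ 2 * expR `|t|)%:C.
  apply: (le_trans hN).
  have r0 : 0 <= r by rewrite -ler0c -rE.
  have r1 : r <= 1 by rewrite -lecR -rE.
  rewrite rE -rmorphXn -rmorphM lecR exprMn [leRHS]mulrA.
  apply: ler_pM; rewrite ?divr_ge0 ?mulr_ge0 ?sqr_ge0 ?expR_ge0 //.
    by rewrite ler_piMr ?mulr_ge0 ?sqr_ge0 // invf_le1 ?ltr0n // ler1n.
  by rewrite ler_expR ler_piMl.
have hp : 0 < `|h| by rewrite normr_gt0.
apply: (@le_trans _ _ (`|h| * M)); last by rewrite -ler_pdivlMr.
apply: (@le_trans _ _ (`|h|^-1 * (`|h| ^+ 2 * (`|t| ^+ 2 * expR `|t|)%:C) * `|expt t z|)).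
  by rewrite ler_wpM2r // ler_wpM2l // invr_ge0 ltW.
rewrite (expr2 `|h|) -!mulrA mulKf ?gt_eqF // ler_wpM2l ?(ltW hp) // mulrC.
by rewrite ler_wpDr // (expr2 `|t|) -(mulrA `|t|).
Unshelve. all: by end_near. Qed.

Lemma is_derive_cpoly (q : {poly C}) (z : C) :
  is_derive (z : C^o) (1 : C^o) (horner q : C^o -> C^o) q^`().[z].
Proof.
elim/poly_ind: q => [|q c ih].
  rewrite (_ : horner 0 = cst 0); last by apply/funext => w; rewrite horner0.
  by rewrite deriv0 horner0; apply: is_derive_cst.
rewrite (_ : horner _ = (horner q : C^o -> C^o) * (id : C^o -> C^o) + cst c); last first.
  by apply/funext => w; rewrite !hornerE.
apply: is_derive_eq.
by rewrite derivD derivM derivX derivC !hornerE /GRing.scale /= addrC; ring.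
Qed.

(** The operator on [q] induced by differentiating [q(z) exp(t z)]. *)
Definition exp_deriv (t : R) (q : {poly C}) : {poly C} := q^`() + t%:C *: q.

Lemma derive1n_poly_expt (t : R) N (q : {poly C}) :
  derive1n N (fun z => q.[z] * expt t z : C^o) =
  (fun z => (iter N (exp_deriv t) q).[z] * expt t z).
Proof.
elim: N q => [//|N IH] q.
rewrite derive1nS IH; apply/funext => z; rewrite derive1E.
set p := iter N _ q.
rewrite (_ : (fun x => _) = (horner p : C^o -> C^o) * (expt t : C^o -> C^o)) //.
have d1 := is_derive_cpoly p z; have d2 := is_derive_expt t z.
rewrite (@derive_val _ _ _ _ _ _ _ (is_deriveM d1 d2)) iterS -/p /exp_deriv.
by rewrite hornerD hornerZ /GRing.scale /=; move: (expt t z) => e; ring.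
Qed.

End ComplexDerivative.

(** * Locally uniform approximation by polynomials *)

Section Approximation.
Variable R : realType.
Local Notation C := R[i].

(** Locally uniform convergence of the polynomials [P K] to [f]. *)
Definition poly_approx (f : C -> C) (P : nat -> {poly C}) :=
  forall rho e : R, 0 < e -> exists K0, forall K, (K0 <= K)%N ->
    forall z, `|z| <= rho%:C -> `|f z - (P K).[z]| <= e%:C.

Lemma poly_bounded (q : {poly C}) (rho : R) :
  exists2 B : R, 0 < B & forall z, `|z| <= rho%:C -> `|q.[z]| <= B%:C.
Proof.
elim/poly_ind: q => [|q c [B B0 IH]].
  by exists 1 => // z _; rewrite horner0 normr0 ler0c.
have [r cE] := norm_is_real c.
have r0 : 0 <= r by rewrite -ler0c -cE.
exists (B * `|rho| + r + 1) => [|z zr].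
  by rewrite ltr_wpDl // addr_ge0 ?mulr_ge0 ?(ltW B0).
rewrite hornerD hornerC hornerMX (le_trans (ler_normD _ _)) // normrM cE.
rewrite !rmorphD rmorphM -addrA lerD //.
  by rewrite ler_pM ?IH // (le_trans zr) // lecR ler_norm.
by rewrite rmorph1 lerDl.
Qed.

Lemma poly_approxD f g P Q : poly_approx f P -> poly_approx g Q ->
  poly_approx (fun z => f z + g z) (fun K => P K + Q K).
Proof.
move=> fP gQ rho e e0; have e2 : 0 < e / 2 by rewrite divr_gt0.
have [K1 h1] := fP rho _ e2; have [K2 h2] := gQ rho _ e2.
exists (maxn K1 K2) => K; rewrite geq_max => /andP[k1 k2] z zr.
rewrite hornerD opprD addrACA (le_trans (ler_normD _ _)) //.
by rewrite [e in e%:C]splitr rmorphD lerD ?h1 ?h2.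
Qed.

Lemma poly_approx_shift f P : poly_approx f P -> poly_approx f (fun K => P K.-1).
Proof.
move=> fP rho e e0; have [K0 h] := fP rho e e0; exists K0.+1 => -[//|K] k z zr.
exact: h.
Qed.

Lemma poly_approxM q f P : poly_approx f P ->
  poly_approx (fun z => q.[z] * f z) (fun K => q * P K).
Proof.
move=> fP rho e e0; have [B B0 qB] := poly_bounded q rho.
have [K0 h] := fP rho _ (divr_gt0 e0 B0); exists K0 => K k z zr.
rewrite hornerM -mulrBr normrM.
have -> : e = B * (e / B) by rewrite mulrC divfK ?gt_eqF.
by rewrite rmorphM ler_pM ?qB ?h.
Qed.

Definition expt_poly (t : R) K : {poly C} := exp_poly R K \Po (t%:C *: 'X).

Lemma poly_approx_expt t : poly_approx (expt t) (expt_poly t).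
Proof.
move=> rho e e0.
have := @cvg_exp_coeff R (`|rho| * `|t|) => /cvgrPdist_le /(_ (e / expR (`|rho| * `|t|))).
rewrite divr_gt0 ?expR_gt0 // => /(_ isT) [K0 _ h]; exists K0 => K k z zr.
rewrite /expt_poly horner_comp hornerZ hornerX mulrC.
have zt : `|z * t%:C| <= (`|rho| * `|t|)%:C.
  rewrite normrM normc_real rmorphM ler_pM ?normr_ge0 ?ler0c //.
  by apply: le_trans zr _; rewrite lecR ler_norm.
rewrite (le_trans (cexp_remainder K zt)) // lecR -ler_pdivlMr ?expR_gt0 //.
have := h K k; rewrite /= sub0r normrN ger0_norm //.
by rewrite divr_ge0 ?exprn_ge0 ?mulr_ge0.
Qed.

Lemma deriv_expt_poly t K : (expt_poly t K)^`() = t%:C *: expt_poly t K.-1.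
Proof.
by rewrite /expt_poly deriv_comp deriv_exp_poly derivZ derivX alg_polyC mulrC mul_polyC.
Qed.

Lemma exp_derivD t N (p q : {poly C}) :
  iter N (exp_deriv t) (p + q) = iter N (exp_deriv t) p + iter N (exp_deriv t) q.
Proof.
elim: N => [//|N IH]; rewrite !iterS IH /exp_deriv derivD scalerDr.
by rewrite addrACA.
Qed.

(** Differentiating [q * expt_poly t K] yields [q^`() * expt_poly t K] plus
    [t q] times [expt_poly t K.-1]: up to a shift of the index, the operator
    [exp_deriv t] acting on [q]. *)
Lemma poly_approx_derivn t N (q : {poly C}) :
  poly_approx (fun z => (iter N (exp_deriv t) q).[z] * expt t z)
         (fun K => (q * expt_poly t K)^`(N)).
Proof.
elim: N q => [|N IH] q; first exact: poly_approxM (poly_approx_expt t).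
have := poly_approxD (IH q^`()) (poly_approx_shift (IH (t%:C *: q))).
move=> h rho e e0; have [K0 {}h] := h rho e e0; exists K0 => K k z zr.
rewrite derivSn derivM deriv_expt_poly -scalerAr scalerAl derivnD.
by rewrite iterSr {2}/exp_deriv exp_derivD hornerD mulrDl h.
Qed.

End Approximation.

(** * Continuity and integration of complex-valued functions *)

Section ComplexContinuity.
Variables (R : realType) (T : topologicalType).
Local Notation C := R[i].
Local Notation re := (@complex.Re R).
Local Notation im := (@complex.Im R).
Implicit Types f g : T -> C.

(** Componentwise, so that it matches the definition of [cintegral]. *)
Definition ccontinuous f := continuous (re \o f) /\ continuous (im \o f).

Lemma ccontinuous_cst (c : C) : ccontinuous (fun=> c).
Proof. by split=> x; apply: cvg_cst. Qed.

Lemma ccontinuous_ofreal (h : T -> R) :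
  continuous h -> ccontinuous (fun x => (h x)%:C).
Proof. by move=> ch; split=> x; [exact: ch|exact: cvg_cst]. Qed.

Lemma ccontinuousD f g :
  ccontinuous f -> ccontinuous g -> ccontinuous (fun x => f x + g x).
Proof.
move=> [f1 f2] [g1 g2]; split=> x.
  rewrite (_ : _ \o _ = (re \o f) + (re \o g)).
    by apply: continuousD; [exact: f1|exact: g1].
  by apply/funext => y /=; rewrite ReD.
rewrite (_ : _ \o _ = (im \o f) + (im \o g)).
  by apply: continuousD; [exact: f2|exact: g2].
by apply/funext => y /=; rewrite ImD.
Qed.

Lemma ccontinuousM f g :
  ccontinuous f -> ccontinuous g -> ccontinuous (fun x => f x * g x).
Proof.
move=> [f1 f2] [g1 g2]; split=> x.
  rewrite (_ : _ \o _ = (re \o f) * (re \o g) - (im \o f) * (im \o g)).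
    by apply: continuousB; apply: continuousM; [exact: f1|exact: g1|exact: f2|exact: g2].
  by apply/funext => y /=; rewrite ReM.
rewrite (_ : _ \o _ = (re \o f) * (im \o g) + (im \o f) * (re \o g)).
  by apply: continuousD; apply: continuousM; [exact: f1|exact: g2|exact: f2|exact: g1].
by apply/funext => y /=; rewrite ImM.
Qed.

Lemma ccontinuousV f : (forall x, f x != 0) ->
  ccontinuous f -> ccontinuous (fun x => (f x)^-1).
Proof.
move=> f0 [f1 f2].
pose N x := (re (f x)) ^+ 2 + (im (f x)) ^+ 2.
have N0 x : N x != 0.
  apply: contra (f0 x); rewrite /N paddr_eq0 ?sqr_ge0 // !sqrf_eq0.
  by rewrite eq_complex.
have cN x : {for x, continuous (fun x => (N x)^-1)}.
  apply: continuousV => //.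
  rewrite (_ : N = (re \o f) * (re \o f) + (im \o f) * (im \o f)).
    by apply: continuousD; apply: continuousM; [exact: f1|exact: f1|exact: f2|exact: f2].
  by apply/funext => y; rewrite /N /= !expr2.
split=> x.
  rewrite (_ : _ \o _ = (re \o f) * (fun x => (N x)^-1)).
    by apply: continuousM; [exact: f1|exact: cN].
  by apply/funext => y; rewrite /N !fctE /=; case: (f y).
rewrite (_ : _ \o _ = - (im \o f) * (fun x => (N x)^-1)).
  by apply: continuousM; [apply: continuousN; exact: f2|exact: cN].
by apply/funext => y; rewrite /N !fctE /=; case: (f y) => a b /=; rewrite mulNr.
Qed.

Lemma ccontinuous_cexp f : ccontinuous f -> ccontinuous (fun x => cexp (f x)).
Proof.
move=> [f1 f2]; apply: ccontinuousM; split=> x.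
- by apply: (continuous_comp (f1 x)); apply: continuous_expR.
- exact: cvg_cst.
- by apply: (continuous_comp (f2 x)); apply: continuous_cos.
- by apply: (continuous_comp (f2 x)); apply: continuous_sin.
Qed.

Lemma ccontinuous_sum (I : Type) (s : seq I) (P : pred I) (F : I -> T -> C) :
  (forall i, P i -> ccontinuous (F i)) -> ccontinuous (fun x => \sum_(i <- s | P i) F i x).
Proof.
move=> cF; elim: s => [|i s IH].
  rewrite (_ : (fun x => _) = (fun=> 0)); first exact: ccontinuous_cst.
  by apply/funext => x; rewrite big_nil.
rewrite (_ : (fun x => _) = fun x => (if P i then F i x else 0) +
   \sum_(i <- s | P i) F i x); last first.
  by apply/funext => x; rewrite big_cons; case: ifP => _; rewrite ?add0r.
by apply: ccontinuousD => //; case: (boolP (P i)) => [/cF//|_]; exact: ccontinuous_cst.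
Qed.

Lemma ccontinuous_prod (I : Type) (s : seq I) (P : pred I) (F : I -> T -> C) :
  (forall i, P i -> ccontinuous (F i)) -> ccontinuous (fun x => \prod_(i <- s | P i) F i x).
Proof.
move=> cF; elim: s => [|i s IH].
  rewrite (_ : (fun x => _) = (fun=> 1)); first exact: ccontinuous_cst.
  by apply/funext => x; rewrite big_nil.
rewrite (_ : (fun x => _) = fun x => (if P i then F i x else 1) *
   \prod_(i <- s | P i) F i x); last first.
  by apply/funext => x; rewrite big_cons; case: ifP => _; rewrite ?mul1r.
by apply: ccontinuousM => //; case: (boolP (P i)) => [/cF//|_]; exact: ccontinuous_cst.
Qed.

Lemma ccontinuous_horner (p : {poly C}) f :
  ccontinuous f -> ccontinuous (fun x => p.[f x]).
Proof.
move=> cf; elim/poly_ind: p => [|p c IH].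
  rewrite (_ : (fun x => _) = (fun=> 0)); first exact: ccontinuous_cst.
  by apply/funext => x; rewrite horner0.
rewrite (_ : (fun x => _) = fun x => p.[f x] * f x + c); last first.
  by apply/funext => x; rewrite !hornerE.
by apply: ccontinuousD (ccontinuous_cst _); apply: ccontinuousM.
Qed.

Lemma ccontinuous_det n (A : T -> 'M[C]_n) :
  (forall i j, ccontinuous (fun x => A x i j)) -> ccontinuous (fun x => \det (A x)).
Proof.
move=> cA; apply: ccontinuous_sum => s _.
apply: ccontinuousM; first exact: ccontinuous_cst.
by apply: ccontinuous_prod => i _.
Qed.

Lemma ccontinuous_invmx n (A : T -> 'M[C]_n) i j :
  (forall x, A x \in unitmx) ->
  (forall i j, ccontinuous (fun x => A x i j)) ->
  ccontinuous (fun x => invmx (A x) i j).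
Proof.
move=> Au cA.
rewrite (_ : (fun x => _) = fun x => (\det (A x))^-1 * cofactor (A x) j i); last first.
  by apply/funext => x; rewrite /invmx Au !mxE.
apply: ccontinuousM.
  apply: ccontinuousV; last exact: ccontinuous_det.
  by move=> x; have := Au x; rewrite unitmxE unitfE.
apply: ccontinuousM; first exact: ccontinuous_cst.
apply: ccontinuous_det => k l.
rewrite (_ : (fun x => _) = fun x => A x (lift j k) (lift i l)) //.
by apply/funext => x; rewrite !mxE.
Qed.

End ComplexContinuity.

Section ComplexIntegral.
Variable R : realType.
Local Notation C := R[i].
Local Notation re := (@complex.Re R).
Local Notation im := (@complex.Im R).
Implicit Types (f g : R -> C) (a b : R).
Local Notation mu := (@lebesgue_measure R).

Lemma continuous_itv_integrable a b (f : R -> R) : continuous f ->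
  mu.-integrable `[a, b]%classic (EFin \o f).
Proof.
move=> cf; apply: continuous_compact_integrable; first exact: segment_compact.
exact: continuous_subspaceT.
Qed.

Lemma cintegralD a b f g : ccontinuous f -> ccontinuous g ->
  cintegral a b (fun x => f x + g x) = cintegral a b f + cintegral a b g.
Proof.
move=> [f1 f2] [g1 g2]; rewrite /cintegral.
have -> : (fun x => complex.Re (f x + g x)) = (fun x => re (f x) + re (g x)).
  by apply/funext => x; rewrite ReD.
have -> : (fun x => complex.Im (f x + g x)) = (fun x => im (f x) + im (g x)).
  by apply/funext => x; rewrite ImD.
by rewrite !RintegralD //; exact: continuous_itv_integrable.
Qed.

Lemma cintegralZ a b f (c : C) : ccontinuous f ->
  cintegral a b (fun x => c * f x) = c * cintegral a b f.
Proof.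
move=> [f1 f2]; rewrite /cintegral.
have -> : (fun x => complex.Re (c * f x)) = (fun x => re c * re (f x) - im c * im (f x)).
  by apply/funext => x; rewrite ReM.
have -> : (fun x => complex.Im (c * f x)) = (fun x => re c * im (f x) + im c * re (f x)).
  by apply/funext => x; rewrite ImM.
have i1 := continuous_itv_integrable a b f1.
have i2 := continuous_itv_integrable a b f2.
have cZ (r : R) (h : R -> R) : continuous h -> continuous (fun x => r * h x).
  by move=> ch x; apply: cvgM; [exact: cvg_cst|exact: ch].
have j11 := continuous_itv_integrable a b (cZ (re c) _ f1).
have j12 := continuous_itv_integrable a b (cZ (im c) _ f1).
have j21 := continuous_itv_integrable a b (cZ (re c) _ f2).
have j22 := continuous_itv_integrable a b (cZ (im c) _ f2).
rewrite RintegralB // RintegralD // !RintegralZl //.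
by case: c {cZ j11 j12 j21 j22} => x y.
Qed.

Lemma Rintegral_le_cst a b (f : R -> R) (c : R) : a <= b -> continuous f ->
    (forall x, a <= x <= b -> `|f x| <= c) ->
  `|\int[mu]_(x in `[a, b]) f x| <= (b - a) * c.
Proof.
move=> ab cf fc; have fi := continuous_itv_integrable a b cf.
rewrite (le_trans (le_normr_Rintegral _ fi)) //.
have cn : continuous (fun x => `|f x|).
  by move=> x; apply: cvg_norm; exact: cf.
have cc : continuous (fun _ : R => c) by move=> x; exact: cvg_cst.
rewrite (le_trans (le_Rintegral _ (continuous_itv_integrable a b cn)
  (continuous_itv_integrable a b cc) _)) //.
rewrite Rintegral_cst //.
rewrite [X in fine X](_ : _ = (b - a)%:E) /=; first by rewrite mulrC.
apply: etrans (lebesgue_measure_itv _) _; rewrite /= lte_fin.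
case: ltP => // ba; suff -> : b = a by rewrite subrr.
by apply/le_anti; rewrite ab ba.
Qed.

(** The factor 2 comes from bounding the two components separately. *)
Lemma cintegral_le a b f (c : R) : a <= b -> ccontinuous f ->
    (forall x, a <= x <= b -> `|f x| <= c%:C) ->
  `|cintegral a b f| <= (2 * (b - a) * c)%:C.
Proof.
move=> ab [f1 f2] fc.
have le1 (z : C) : `|re z| <= complex.Re `|z|.
  by rewrite -lecR RRe_real ?normr_real ?normc_ge_Re.
have le2 (z : C) : `|im z| <= complex.Re `|z|.
  rewrite -lecR RRe_real ?normr_real //.
  have := normc_ge_Re (z * 'i%C); rewrite normrM ReiNIm normrN.
  by rewrite [X in _ * X]normc_def /= expr0n expr1n add0r sqrtr1 mulr1.
have key (x y r : R) : `|x| <= r -> `|y| <= r -> `|x +i* y| <= (2 * r)%:C.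
  move=> xr yr; rewrite [x +i* y]complexE /= (le_trans (ler_normD _ _)) // normrM.
  rewrite normci mul1r !normc_real.
  by rewrite -rmorphD lecR mulr_natl mulr2n lerD.
have I1 : `|\int[mu]_(x in `[a, b]) complex.Re (f x)| <= (b - a) * c.
  apply: Rintegral_le_cst => // x /fc; rewrite -lecR; apply: le_trans.
  exact: normc_ge_Re.
have I2 : `|\int[mu]_(x in `[a, b]) complex.Im (f x)| <= (b - a) * c.
  apply: Rintegral_le_cst => // x /fc fx; apply: le_trans (le2 _) _.
  by rewrite -lecR RRe_real ?normr_real.
by rewrite -mulrA; apply: key.
Qed.

Lemma cintegral_FTC a b F f : a < b -> cderive F f -> ccontinuous f ->
  cintegral a b f = F b - F a.
Proof.
move=> ab dF [f1 f2].
have FTC (G g : R -> R) : continuous g -> (forall x : R, is_derive x (1 : R) G (g x)) ->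
    \int[mu]_(x in `[a, b]) g x = G b - G a.
  move=> cg dG; have cG : continuous G.
    move=> x; apply: differentiable_continuous; apply/derivable1_diffP.
    exact: (@ex_derive _ _ _ _ _ _ _ (dG x)).
  rewrite /Rintegral (continuous_FTC2 ab _ _ (F := G)) //.
  - exact: continuous_subspaceT.
  - split=> [x _||].
    + exact: (@ex_derive _ _ _ _ _ _ _ (dG x)).
    + exact: cvg_at_right_filter (cG a).
    + exact: cvg_at_left_filter (cG b).
  - by move=> x _; rewrite derive1E (@derive_val _ _ _ _ _ _ _ (dG x)).
rewrite /cintegral (FTC _ _ f1 (fun x => (dF x).1)) (FTC _ _ f2 (fun x => (dF x).2)).
by rewrite /=; case: (F b) => ? ?; case: (F a).
Qed.

End ComplexIntegral.

(** * Cauchy integrals over circles *)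

Section CauchyIntegral.
Variable R : realType.
Local Notation C := R[i].
Implicit Types (r : R) (h : C -> C).

Definition circle_point r (theta : R) : C := r%:C * cexp ('i * theta%:C).

Lemma norm_circle_point r theta : 0 <= r -> `|circle_point r theta| = r%:C.
Proof.
move=> r0; rewrite normrM normc_real (ger0_norm r0) norm_cexp ReM /=.
by rewrite mul0r mulr0 subrr expR0 mulr1.
Qed.

Lemma circle_point_neq0 r theta : 0 < r -> circle_point r theta != 0.
Proof. by move=> r0; rewrite -normr_gt0 norm_circle_point ?ltcR // ltW. Qed.

Lemma ccontinuous_real : ccontinuous (fun x : R => x%:C).
Proof. by apply: ccontinuous_ofreal => x; exact: cvg_id. Qed.

Lemma ccontinuous_circle_point r : ccontinuous (circle_point r).
Proof.
apply: ccontinuousM; first exact: ccontinuous_cst.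
apply: ccontinuous_cexp; apply: ccontinuousM; first exact: ccontinuous_cst.
exact: ccontinuous_real.
Qed.

Definition cauchy_integral r h : C := ((2 * pi)%:C * 'i)^-1 * circle_integral r h.

Definition circle_continuous r h := ccontinuous (fun theta => h (circle_point r theta)).

Lemma circle_continuous_form r h : circle_continuous r h ->
  ccontinuous (fun theta => h (circle_point r theta) * ('i * circle_point r theta)).
Proof.
move=> ch; apply: ccontinuousM => //; apply: ccontinuousM (ccontinuous_circle_point r).
exact: ccontinuous_cst.
Qed.

Lemma cauchy_integralD r h g : circle_continuous r h -> circle_continuous r g ->
  cauchy_integral r (fun z => h z + g z) = cauchy_integral r h + cauchy_integral r g.
Proof.
move=> ch cg; rewrite /cauchy_integral -mulrDr; congr (_ * _).
rewrite /circle_integral -cintegralD; try exact: circle_continuous_form.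
by congr cintegral; apply/funext => x; rewrite mulrDl.
Qed.

Lemma cauchy_integralZ r h (c : C) : circle_continuous r h ->
  cauchy_integral r (fun z => c * h z) = c * cauchy_integral r h.
Proof.
move=> ch; rewrite /cauchy_integral mulrCA; congr (_ * _).
rewrite /circle_integral -cintegralZ; try exact: circle_continuous_form.
by congr cintegral; apply/funext => x; rewrite mulrA.
Qed.

Lemma cauchy_integral0 r : cauchy_integral r (fun=> 0) = 0.
Proof.
rewrite -[RHS](mul0r (cauchy_integral r (fun=> 0))) -cauchy_integralZ; last exact: ccontinuous_cst.
by congr cauchy_integral; apply/funext => z; rewrite mul0r.
Qed.

Lemma cauchy_integral_sum (I : Type) (s : seq I) r (F : I -> C -> C) :
  (forall i, circle_continuous r (F i)) ->
  cauchy_integral r (fun z => \sum_(i <- s) F i z) = \sum_(i <- s) cauchy_integral r (F i).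
Proof.
move=> cF; elim: s => [|i s IH].
  rewrite big_nil -[RHS](cauchy_integral0 r); congr cauchy_integral; apply/funext => z.
  by rewrite big_nil.
rewrite big_cons -IH -cauchy_integralD //; last first.
  by apply: (ccontinuous_sum _ (F := fun i theta => F i (circle_point r theta))) => j _; apply: cF.
by congr cauchy_integral; apply/funext => z; rewrite big_cons.
Qed.

Lemma pi2_gt0 : 0 < 2 * pi :> R.
Proof. by rewrite mulr_gt0 ?pi_gt0. Qed.

Lemma cauchy_integral_le r h (c : R) : 0 <= r -> circle_continuous r h ->
    (forall z, `|z| = r%:C -> `|h z| <= c%:C) ->
  `|cauchy_integral r h| <= (2 * r * c)%:C.
Proof.
move=> r0 ch hc; have p0 := pi2_gt0.
have : `|circle_integral r h| <= (2 * (2 * pi - 0) * (c * r))%:C.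
  apply: cintegral_le; [exact: ltW|exact: circle_continuous_form|move=> x _].
  rewrite normrM [`|'i * _|]normrM normci mul1r -/(circle_point r x) norm_circle_point // rmorphM.
  by rewrite ler_wpM2r ?ler0c // hc ?norm_circle_point.
rewrite subr0 => hI; rewrite /cauchy_integral normrM normfV normrM normci mulr1 normc_real.
rewrite (gtr0_norm p0) mulrC ler_pdivrMr ?ltcR // -rmorphM (le_trans hI) // lecR.
by rewrite le_eqVlt; apply/orP; left; apply/eqP; ring.
Qed.

(** Orthogonality of the powers of [z] on the circle: on it the integrand is a
    constant times [exp(c theta)] with [c = i (k - j)], which for [c] nonzero is
    the derivative of a function of period [2 pi]. *)
Lemma cauchy_integral_monomial r k j : 0 < r ->
  cauchy_integral r (fun z => z ^+ k * z^-1 ^+ j.+1) = (j == k)%:R.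
Proof.
move=> r0; rewrite /cauchy_integral /circle_integral.
have rn0 : r%:C != 0 :> C by rewrite -[0]/(0%:C) (inj_eq (@complexI R)) gt_eqF.
pose c : C := 'i * (k%:R - j%:R).
have cexpMn (z : C) n : cexp z ^+ n = cexp (z *+ n).
  by elim: n => [|n IH]; rewrite ?expr0 ?mulr0n ?cexp0 // exprS IH mulrS cexpD.
have cexpN (z : C) : (cexp z)^-1 = cexp (- z).
  have zN : cexp z * cexp (- z) = 1 by rewrite -cexpD subrr cexp0.
  have z0 : cexp z != 0 by apply: contra_eqN zN => /eqP ->; rewrite mul0r eq_sym oner_neq0.
  by rewrite -[LHS]mulr1 -zN mulKf.
have powE theta : cexp ('i * theta%:C) ^+ k * (cexp ('i * theta%:C))^-1 ^+ j =
    cexp (c * theta%:C).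
  rewrite cexpN !cexpMn -cexpD; congr cexp.
  by rewrite /c -[_ *+ k]mulr_natr -[_ *+ j]mulr_natr; ring.
have formE : (fun theta : R => let z := r%:C * cexp ('i * theta%:C) in
      z ^+ k * z^-1 ^+ j.+1 * ('i * z)) =
    (fun theta => (r%:C ^+ k * r%:C^-1 ^+ j * 'i) * cexp (c * theta%:C)).
  apply/funext => theta /=; rewrite -powE.
  have e0 := circle_point_neq0 theta r0; rewrite /circle_point mulf_eq0 negb_or in e0.
  case/andP: e0 => _ e0; move: (cexp _) e0 => e e0.
  have zE : (r%:C * e)^-1 ^+ j.+1 * ('i * (r%:C * e)) = (r%:C * e)^-1 ^+ j * 'i.
    by rewrite exprSr -mulrA ['i * _]mulrC mulKf ?mulf_neq0.
  by rewrite -mulrA zE invfM !exprMn; ring.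
rewrite formE; have [jk|jk] := eqVneq j k.
  have c0 : c = 0 by rewrite /c jk subrr mulr0.
  rewrite jk -exprMn mulfV // expr1n mul1r c0.
  have F : cderive (fun theta : R => 'i * theta%:C) (fun theta => 'i * cexp (0 * theta%:C)).
    apply: (cderive_eq (cderiveM (cderive_cst 'i) (@cderive_id R))).
    by move=> x /=; rewrite !mul0r add0r cexp0.
  rewrite (cintegral_FTC pi2_gt0 F); last first.
    apply: ccontinuousM; first exact: ccontinuous_cst.
    apply: ccontinuous_cexp; apply: ccontinuousM; first exact: ccontinuous_cst.
    exact: ccontinuous_real.
  rewrite rmorph0 mulr0 subr0 mulrC [_ * 'i]mulrC divff // mulf_neq0 //.
    by rewrite -normr_gt0 normci ltr01.
  by rewrite -[0]/(0%:C) (inj_eq (@complexI R)) gt_eqF // pi2_gt0.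
have c0 : c != 0.
  rewrite mulf_neq0 //; first by rewrite -normr_gt0 normci ltr01.
  by rewrite subr_eq0 eqr_nat eq_sym.
have cc : ccontinuous (fun theta : R => cexp (c * theta%:C)).
  apply: ccontinuous_cexp; apply: ccontinuousM; first exact: ccontinuous_cst.
  exact: ccontinuous_real.
rewrite cintegralZ //.
suff -> : cintegral 0 (2 * pi) (fun theta => cexp (c * theta%:C)) = 0 by rewrite !mulr0.
apply: (mulfI c0); rewrite mulr0 -cintegralZ //.
rewrite (cintegral_FTC pi2_gt0 (cderive_cexp_line c)).
  have e1 : cexp ('i * (2 * pi)%:C) = 1 :> C.
    rewrite /cexp ReM ImM /= !mul0r mulr0 subr0 mul1r add0r expR0.
    by rewrite mulr_natl cos2pi sin2pi mul1r.
  by rewrite -!powE e1 rmorph0 mulr0 cexp0 invr1 !expr1n mulr1 subrr.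
by apply: ccontinuousM => //; exact: ccontinuous_cst.
Qed.

End CauchyIntegral.

(** * Matrix functions *)

Lemma le0_geometric (R : realType) (x K q : R) : 0 <= q < 1 ->
  (forall M, x <= K * q ^+ M) -> x <= 0.
Proof.
move=> /andP[q0 q1] xK; rewrite leNgt; apply/negP => x0.
have K0 : 0 < K by have := xK 0%N; rewrite expr0 mulr1; apply: lt_le_trans.
have qn : `|q| < 1 by rewrite ger0_norm.
have := cvg_expr qn => /cvgrPdist_lt /(_ (x / K)).
rewrite divr_gt0 // => /(_ isT) [M _ /(_ M (leqnn M))].
rewrite sub0r normrN ger0_norm ?exprn_ge0 // ltr_pdivlMr // mulrC ltNge.
by rewrite xK.
Qed.

Section MatrixFunction.
Variables (R : realType) (n : nat).
Local Notation C := R[i].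
Implicit Types (A B X Y : 'M[C]_n.+1).

(** A submultiplicative norm for which [mxradius B] is [1 + sumnorm B]. *)
Definition sumnorm X : C := \sum_i \sum_j `|X i j|.

Lemma sumnorm_ge0 X : 0 <= sumnorm X.
Proof. by do 2!apply: sumr_ge0 => *. Qed.

Lemma entry_le_sumnorm X i j : `|X i j| <= sumnorm X.
Proof.
rewrite /sumnorm (bigD1 i) //= (bigD1 j) //= -addrA lerDl addr_ge0 //.
  by apply: sumr_ge0.
by do 2!apply: sumr_ge0 => *.
Qed.

Lemma sumnormD X Y : sumnorm (X + Y) <= sumnorm X + sumnorm Y.
Proof.
rewrite /sumnorm -big_split; apply: ler_sum => i _.
rewrite -big_split; apply: ler_sum => j _; rewrite mxE; exact: ler_normD.
Qed.

Lemma sumnormZ (c : C) X : sumnorm (c *: X) = `|c| * sumnorm X.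
Proof.
rewrite /sumnorm mulr_sumr; apply: eq_bigr => i _.
by rewrite mulr_sumr; apply: eq_bigr => j _; rewrite mxE normrM.
Qed.

Lemma sumnorm1 : sumnorm 1%:M = n.+1%:R.
Proof.
rewrite -[in RHS](card_ord n.+1) -sumr_const; apply: eq_bigr => i _.
rewrite (bigD1 i) //= mxE eqxx normr1 big1 ?addr0 // => j ji.
by rewrite mxE eq_sym (negbTE ji) normr0.
Qed.

Lemma sumnormM X Y : sumnorm (X *m Y) <= sumnorm X * sumnorm Y.
Proof.
rewrite {2}/sumnorm mulr_suml; apply: ler_sum => i _.
apply: (@le_trans _ _ (\sum_k \sum_j `|X i j| * `|Y j k|)).
  apply: ler_sum => k _; rewrite mxE (le_trans (ler_norm_sum _ _ _)) //.
  by apply: ler_sum => j _; rewrite normrM.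
rewrite exchange_big mulr_suml; apply: ler_sum => j _.
rewrite -mulr_sumr ler_wpM2l // /sumnorm [leRHS](bigD1 j) //= lerDl.
by do 2!apply: sumr_ge0 => *.
Qed.

Lemma sumnormX X k : sumnorm (X ^+ k) <= n.+1%:R * sumnorm X ^+ k.
Proof.
elim: k => [|k IH]; first by rewrite !expr0 mulr1 sumnorm1.
rewrite exprSr (le_trans (sumnormM _ _)) // exprSr mulrA ler_wpM2r //.
exact: sumnorm_ge0.
Qed.

Lemma mxradiusE B : (mxradius B)%:C = 1 + sumnorm B.
Proof.
rewrite /mxradius rmorphD rmorph1 rmorph_sum; congr (_ + _).
apply: eq_bigr => i _; rewrite rmorph_sum; apply: eq_bigr => j _.
by apply: RRe_real; exact: normr_real.
Qed.

Lemma mxradius_gt0 B : 0 < mxradius B.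
Proof. by rewrite -ltcR mxradiusE ltr_wpDr ?sumnorm_ge0. Qed.

Lemma resolvent_unitmx B z : ~~ eigenvalue B z -> z%:M - B \in unitmx.
Proof.
rewrite /eigenvalue /eigenspace negbK => /eqP k0.
rewrite -row_free_unit -kermx_eq0; apply/eqP.
rewrite -(opprB B) -[- _]scaleN1r; apply/eqP.
rewrite -mxrank_eq0 mxrank_ker mxrank_scale_nz ?oppr_eq0 ?oner_eq0 //.
by rewrite -mxrank_ker k0 mxrank0.
Qed.

Section Circle.
Variable B : 'M[C]_n.+1.
Let r := mxradius B.
Let res z := invmx (z%:M - B).

Lemma circle_unitmx z : `|z| = r%:C -> z%:M - B \in unitmx.
Proof.
move=> zr; apply: resolvent_unitmx; apply/negP => /eigenvalue_lt_mxradius.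
by rewrite zr ltxx.
Qed.

(** On the circle [z 1 = (z 1 - B) + B] gives [|z| x <= n + 1 + sumnorm B * x]
    for the norm [x] of the resolvent, and [|z|] exceeds [sumnorm B] by exactly 1. *)
Lemma resolvent_le z : `|z| = r%:C -> sumnorm (res z) <= n.+1%:R.
Proof.
move=> zr; have := mulmxV (circle_unitmx zr); rewrite -/(res z) mulmxBl mul_scalar_mx.
move=> /eqP; rewrite subr_eq => /eqP E.
have := sumnormD 1%:M (B *m res z); rewrite -E sumnormZ zr /r mxradiusE sumnorm1.
move=> h; have {h} := le_trans h (lerD (lexx _) (sumnormM _ _)).
by rewrite mulrDl mul1r lerD2r.
Qed.

Lemma circle_continuous_res i j : circle_continuous r (fun z => res z i j).
Proof.
have r0 := mxradius_gt0 B.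
apply: (ccontinuous_invmx (A := fun theta => (circle_point r theta)%:M - B)).
  by move=> x; apply: circle_unitmx; rewrite norm_circle_point // ltW.
move=> k l; rewrite (_ : (fun x => _) = fun x => circle_point r x *+ (k == l) + - B k l).
  apply: ccontinuousD; last exact: ccontinuous_cst.
  by case: (k == l); [exact: ccontinuous_circle_point | exact: ccontinuous_cst].
by apply/funext => x; rewrite !mxE.
Qed.

Lemma circle_continuous_poly (p : {poly C}) : circle_continuous r (horner p).
Proof. by apply: ccontinuous_horner; exact: ccontinuous_circle_point. Qed.

Lemma mxfunE g i j : mxfun g B i j = cauchy_integral r (fun z => g z * res z i j).
Proof. by rewrite mxE. Qed.

Lemma cauchy_integral_ext (h g : C -> C) : (forall z, `|z| = r%:C -> h z = g z) ->
  cauchy_integral r h = cauchy_integral r g.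
Proof.
move=> hg; rewrite /cauchy_integral /circle_integral; congr (_ * cintegral _ _ _).
apply/funext => x /=; rewrite hg // -/(circle_point r x) norm_circle_point //.
exact/ltW/mxradius_gt0.
Qed.

Lemma neumann z N : `|z| = r%:C ->
  res z = \sum_(j < N) z^-1 ^+ j.+1 *: B ^+ j + z^-1 ^+ N *: (B ^+ N *m res z).
Proof.
move=> zr; have z0 : z != 0 by rewrite -normr_gt0 zr ltcR mxradius_gt0.
have step : res z = z^-1 *: (1%:M + B *m res z).
  have := mulmxV (circle_unitmx zr); rewrite -/(res z) mulmxBl mul_scalar_mx.
  by move=> /eqP; rewrite subr_eq => /eqP <-; rewrite scalerA mulVf // scale1r.
elim: N => [|N IH]; first by rewrite big_ord0 add0r !expr0 scale1r mul1mx.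
rewrite [LHS]IH big_ord_recr /= -addrA; congr (_ + _).
rewrite {1}step -scalemxAr mulmxDr mulmx1 scalerA -exprSr scalerDr; congr (_ + _).
by rewrite (exprSr B N); congr (_ *: _); exact: mulmxA.
Qed.

(** In the Neumann expansion of the resolvent only the term [B ^+ k] survives
    integration against [z ^+ k]. Its tail tends to 0 with the order of the
    truncation, since [sumnorm B] is smaller than the radius. *)
Lemma mxfun_monomial k : mxfun (fun z => z ^+ k) B = B ^+ k.
Proof.
apply/matrixP => a b; rewrite mxfunE.
have r0 := mxradius_gt0 B.
have cX j : circle_continuous r (fun z => z ^+ j).
  rewrite (_ : (fun z => _) = horner 'X^j); first exact: circle_continuous_poly.
  by apply/funext => z; rewrite hornerXn.
have cV j : circle_continuous r (fun z => z^-1 ^+ j).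
  rewrite /circle_continuous; elim: j => [|j IH].
    by under eq_fun do rewrite expr0; exact: ccontinuous_cst.
  under eq_fun do rewrite exprS.
  apply: ccontinuousM IH; apply: ccontinuousV (ccontinuous_circle_point _).
  by move=> x; apply: circle_point_neq0.
set I := cauchy_integral _ _.
pose beta := r - 1; have betaE : sumnorm B = beta%:C.
  by apply: (addrI 1); rewrite -mxradiusE /beta rmorphB rmorph1 addrC subrK.
have beta0 : 0 <= beta by rewrite -ler0c -betaE sumnorm_ge0.
pose c := n.+1%:R ^+ 2 * r ^+ k * (beta / r) ^+ k.+1.
have bnd M : `|I - (B ^+ k) a b| <= (2 * r * c * (beta / r) ^+ M)%:C.
  pose err z := z ^+ k * z^-1 ^+ (k.+1 + M) * (B ^+ (k.+1 + M) *m res z) a b.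
  have cerr : circle_continuous r err.
    apply: ccontinuousM; first exact: ccontinuousM (cX k) (cV _).
    rewrite (_ : (fun z => _) = fun x => \sum_l (B ^+ (k.+1 + M)) a l * res (circle_point r x) l b).
      apply: (ccontinuous_sum _ (F := fun l x =>
        (B ^+ (k.+1 + M)) a l * res (circle_point r x) l b)) => l _.
      apply: ccontinuousM; first exact: ccontinuous_cst.
      exact: circle_continuous_res.
    by apply/funext => x; rewrite mxE.
  have -> : I = (B ^+ k) a b + cauchy_integral r err.
    rewrite /I (cauchy_integral_ext (g := fun z => (\sum_(j < k.+1 + M)
         (B ^+ j) a b * (z ^+ k * z^-1 ^+ j.+1)) + err z)); last first.
      move=> z zr; rewrite (neumann (k.+1 + M) zr) mxE summxE mulrDr mulr_sumr.
      congr (_ + _); last first.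
        by rewrite /err -mulrA; congr (_ * _); rewrite mxE.
      by apply: eq_bigr => j _; rewrite mxE [LHS]mulrA [LHS]mulrC.
    have cs j : circle_continuous r (fun z => (B ^+ j) a b * (z ^+ k * z^-1 ^+ j.+1)).
      apply: ccontinuousM; first exact: ccontinuous_cst.
      exact: ccontinuousM (cX k) (cV _).
    rewrite cauchy_integralD //; last first.
      by apply: (ccontinuous_sum _ (F := fun (j : 'I_(k.+1 + M)) x =>
         (B ^+ j) a b * (circle_point r x ^+ k * (circle_point r x)^-1 ^+ j.+1))) => j _; apply: cs.
    rewrite (cauchy_integral_sum _ (F := fun (j : 'I_(k.+1 + M)) z =>
      (B ^+ j) a b * (z ^+ k * z^-1 ^+ j.+1))) //.
    congr (_ + _).
    have kM : (k < k.+1 + M)%N by rewrite ltnS leq_addr.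
    rewrite (bigD1 (Ordinal kM)) //= big1 => [|j jk]; last first.
      rewrite cauchy_integralZ; last exact: ccontinuousM (cX k) (cV _).
      rewrite cauchy_integral_monomial // -[X in _ == X]/(val (Ordinal kM)) (inj_eq val_inj).
      by rewrite (negbTE jk) mulr0.
    rewrite addr0 cauchy_integralZ; last exact: ccontinuousM (cX k) (cV _).
    by rewrite cauchy_integral_monomial // eqxx mulr1.
  rewrite addrAC subrr add0r -mulrA; apply: cauchy_integral_le (ltW r0) cerr _ => z zr.
  rewrite /err !normrM !normrX normfV zr.
  apply: (le_trans (ler_wpM2l _ (entry_le_sumnorm _ _ _))).
    by rewrite mulr_ge0 ?exprn_ge0 ?invr_ge0 // ler0c ltW.
  apply: (le_trans (ler_wpM2l _ (le_trans (sumnormM _ _)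
    (ler_pM (sumnorm_ge0 _) (sumnorm_ge0 _) (sumnormX _ _) (resolvent_le zr))))).
    by rewrite mulr_ge0 ?exprn_ge0 ?invr_ge0 // ler0c ltW.
  rewrite betaE -[n.+1%:R](rmorph_nat (real_complex R)) -fmorphV -!rmorphXn -!rmorphM lecR.
  rewrite /c -[leRHS]mulrA -exprD exprMn le_eqVlt; apply/orP; left; apply/eqP.
  by move: (beta ^+ _) (r^-1 ^+ _) => x y; ring.
apply/eqP; rewrite -subr_eq0 -normr_le0 -[`|_|]RRe_real ?normr_real //.
rewrite -[0]/(0%:C) lecR; apply: (@le0_geometric R _ (2 * r * c) (beta / r)).
  by rewrite divr_ge0 ?(ltW r0) //= ltr_pdivrMr // mul1r /beta gtrBl.
by move=> M; rewrite -lecR RRe_real ?normr_real.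
Qed.

Lemma mxfun_poly (p : {poly C}) : mxfun (horner p) B = horner_mx B p.
Proof.
have r0 := mxradius_gt0 B.
apply/matrixP => a b; rewrite mxfunE.
rewrite (_ : (fun z => _) = fun z => \sum_(k < size p) p`_k * (z ^+ k * res z a b)).
  have cs k : circle_continuous r (fun z => z ^+ k * res z a b).
    apply: ccontinuousM (circle_continuous_res a b).
    rewrite (_ : (fun x => _) = fun x => ('X^k).[circle_point r x]).
      exact: circle_continuous_poly.
    by apply/funext => z; rewrite hornerXn.
  rewrite (cauchy_integral_sum _ (F := fun (k : 'I_(size p)) z => p`_k * (z ^+ k * res z a b))); last first.
    by move=> k; apply: ccontinuousM (cs k); exact: ccontinuous_cst.
  rewrite -[in RHS](coefK p) poly_def rmorph_sum summxE; apply: eq_bigr => k _.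
  rewrite cauchy_integralZ // -mxfunE mxfun_monomial /= horner_mxZ rmorphXn /= horner_mx_X.
  by rewrite mxE.
apply/funext => z; rewrite horner_coef mulr_suml; apply: eq_bigr => k _.
by rewrite mulrA.
Qed.

Lemma mxfun_poly_close (f : C -> C) (p : {poly C}) (e : R) : circle_continuous r f ->
    (forall z, `|z| <= r%:C -> `|f z - p.[z]| <= e%:C) ->
  forall i j, `|mxfun f B i j - horner_mx B p i j| <= (2 * r * (e * n.+1%:R))%:C.
Proof.
move=> cf fp i j; have r0 := mxradius_gt0 B.
have cfR : circle_continuous r (fun z => f z * res z i j).
  by apply: ccontinuousM (circle_continuous_res i j).
have cpR : circle_continuous r (fun z => -1 * (p.[z] * res z i j)).
  apply: ccontinuousM; first exact: ccontinuous_cst.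
  by apply: ccontinuousM (circle_continuous_res i j); exact: circle_continuous_poly.
rewrite -mxfun_poly !mxfunE -mulN1r -cauchy_integralZ; last first.
  by apply: ccontinuousM (circle_continuous_res i j); exact: circle_continuous_poly.
rewrite -cauchy_integralD //; apply: cauchy_integral_le; first exact: ltW.
  exact: ccontinuousD.
move=> z zr; rewrite mulN1r -mulNr -mulrDl normrM rmorphM ler_pM ?fp ?zr //.
by rewrite rmorph_nat (le_trans (entry_le_sumnorm _ _ _)) //; exact: resolvent_le.
Qed.

End Circle.

(** The radius of the contour and the resolvent on it are controlled by
    [sumnorm B] alone, hence the uniformity in [B]. *)
Lemma mxfun_approx (f : C -> C) (P : nat -> {poly C}) (rho e : R) :
    (forall r, circle_continuous r f) -> poly_approx f P -> 0 < e ->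
  exists K0, forall K, (K0 <= K)%N -> forall B, sumnorm B <= rho%:C ->
    forall i j, `|mxfun f B i j - horner_mx B (P K) i j| <= e%:C.
Proof.
move=> cf fP e0; pose rho' := `|rho| + 1.
have rho'0 : 0 < rho' by rewrite ltr_wpDl.
have dp : 0 < 2 * rho' * n.+1%:R by rewrite !mulr_gt0 ?ltr0n.
have [K0 h] := fP rho' (e / (2 * rho' * n.+1%:R)) (divr_gt0 e0 dp).
exists K0 => K k B Brho i j.
have Br : mxradius B <= rho'.
  by rewrite -lecR mxradiusE addrC rmorphD rmorph1 lerD2r (le_trans Brho) // lecR ler_norm.
have hK z : `|z| <= (mxradius B)%:C -> `|f z - (P K).[z]| <= (e / (2 * rho' * n.+1%:R))%:C.
  by move=> zr; apply: h => //; apply: (le_trans zr); rewrite lecR.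
apply: le_trans (mxfun_poly_close (cf _) hK i j) _.
rewrite lecR mulrA mulrAC mulrA ler_pdivrMr // mulrC ler_wpM2l ?(ltW e0) //.
by rewrite ler_wpM2r // ler_wpM2l.
Qed.

End MatrixFunction.

(** * Convex hulls of finite sets *)

Section ConvexHull.
Variables (R : realType) (mh : nat) (mu : 'I_mh -> R[i]).
Local Notation C := R[i].
Let hull : set C := convex_hull (range mu).

Lemma convex_hull_range k : hull (mu k).
Proof. by move=> M [_]; apply; exists k. Qed.

Lemma convex_hull_segment y z (t : R) : 0 <= t <= 1 -> hull y -> hull z ->
  hull ((1 - t%:C) * y + t%:C * z).
Proof.
move=> /andP[t0 t1] hy hz M [cM rM].
have t0' : 0 <= t%:C by rewrite ler0c.
have t1' : t%:C <= 1 :> C by rewrite -[1]/(1%:C) lecR.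
have := cM z y (Itv01 t0' t1'); rewrite !in_setE => /(_ (hz M _) (hy M _)).
by move=> /(_ (conj cM rM) (conj cM rM)); rewrite addrC.
Qed.

(** By induction on a list of points of positive total weight, normalising the
    partial sums: adding a point moves the partial barycentre along a segment. *)
Lemma convex_hull_combination (a : 'I_mh -> R) : (forall k, 0 <= a k) ->
  \sum_k a k = 1 -> hull (\sum_k (a k)%:C * mu k).
Proof.
move=> a0 a1.
suff key (s : seq 'I_mh) : 0 < \sum_(k <- s) a k ->
    hull ((\sum_(k <- s) a k)^-1%:C * \sum_(k <- s) (a k)%:C * mu k).
  have := key (index_enum 'I_mh); rewrite a1 invr1 rmorph1 mul1r; exact.
elim: s => [|k s IH]; first by rewrite big_nil ltxx.
rewrite !big_cons; set S := \sum_(j <- s) a j; set X := \sum_(j <- s) _ => aS.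
have : 0 <= S by apply: sumr_ge0.
rewrite le_eqVlt => /orP[/eqP S0|S0].
  have X0 : X = 0.
    rewrite /X big_seq big1 // => j js.
    suff -> : a j = 0 by rewrite rmorph0 mul0r.
    apply/le_anti; rewrite a0 andbT S0 /S.
    by rewrite (big_rem j) //= lerDl sumr_ge0.
  rewrite X0 -S0 !addr0 mulrA -rmorphM mulVf ?rmorph1 ?mul1r; first exact: convex_hull_range.
  by rewrite -S0 addr0 in aS; rewrite gt_eqF.
have t01 : 0 <= S / (a k + S) <= 1.
  by rewrite divr_ge0 ?(ltW S0) ?(ltW aS) //= ler_pdivrMr // mul1r lerDr.
have := convex_hull_segment t01 (convex_hull_range k) (IH S0).
congr hull; rewrite mulrDr !mulrA -!rmorphM; congr (_ + _).
  congr (_ * _); rewrite -[X in X - _](rmorph1 (real_complex R)) -rmorphB.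
  by congr (_%:C); field; rewrite gt_eqF.
by congr (_%:C * _); rewrite -/S; field; rewrite !gt_eqF.
Qed.

Lemma convex_hull_subset_combination z : hull z ->
  exists a : 'I_mh -> R, [/\ forall k, 0 <= a k, \sum_k a k = 1 &
    z = \sum_k (a k)%:C * mu k].
Proof.
move=> hz; pose D : set C := [set w | exists a : 'I_mh -> R,
  [/\ forall k, 0 <= a k, \sum_k a k = 1 & w = \sum_k (a k)%:C * mu k]].
suff: D z by [].
apply: hz; split=> [y z' l|_ [k _ <-]]; last first.
  exists (fun j => (j == k)%:R); split=> [j||]; first by rewrite ler0n.
    by rewrite (bigD1 k) //= eqxx big1 ?addr0 // => j /negbTE ->.
  rewrite (bigD1 k) //= eqxx rmorph1 mul1r big1 ?addr0 // => j /negbTE ->.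
  by rewrite rmorph0 mul0r.
rewrite !in_setE => -[a [a0 a1 ->]] [b [b0 b1 ->]].
have [s lE] : exists s : R, l%:num = s%:C.
  by exists (complex.Re l%:num); rewrite RRe_real // ger0_real.
have s0 : 0 <= s by rewrite -ler0c -lE.
have s1 : s <= 1 by rewrite -lecR rmorph1 -lE; exact: le1.
exists (fun k => s * a k + (1 - s) * b k); split=> [k||].
- by rewrite addr_ge0 ?mulr_ge0 ?subr_ge0.
- by rewrite big_split /= -!mulr_sumr a1 b1 !mulr1 addrC subrK.
transitivity (s%:C * (\sum_k (a k)%:C * mu k) +
  (1 - s%:C) * (\sum_k (b k)%:C * mu k)); first by rewrite -lE.
rewrite !mulr_sumr -big_split.
apply: eq_bigr => k _ /=.
by rewrite rmorphD !rmorphM rmorphB rmorph1 [RHS]mulrDl -!mulrA.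
Qed.

Lemma convex_hull_bounded : exists rho : R, forall z, hull z -> `|z| <= rho%:C.
Proof.
have [r rE] : exists r : R, \sum_k `|mu k| = r%:C.
  exists (complex.Re (\sum_k `|mu k|)); rewrite RRe_real //.
  by rewrite ger0_real // sumr_ge0.
exists r => z /convex_hull_subset_combination[a [a0 a1 ->]].
rewrite -rE (le_trans (ler_norm_sum _ _ _)) //; apply: ler_sum => k _.
rewrite normrM normc_real (ger0_norm (a0 k)) ler_piMl //.
rewrite -[1]/(1%:C) lecR -a1 (bigD1 k) //= lerDl; exact: sumr_ge0.
Qed.

(** Coordinate 0 of a point of [prism] is the parameter [s] of a homothety, the
    others are barycentric weights. *)
Definition barycenter (x : 'rV[R]_mh.+1) : C :=
  \sum_k (x 0 (lift ord0 k))%:C * mu k.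

Definition prism : set 'rV[R]_mh.+1 := [set x | [/\ forall i, 0 <= x 0 i,
  x 0 ord0 <= 1 & \sum_k x 0 (lift ord0 k) = 1]].

Lemma prism_compact : compact prism.
Proof.
have cc i : continuous (fun x : 'rV[R]_mh.+1 => x 0 i) by exact: coord_continuous.
apply: bounded_closed_compact.
  exists 1; split=> [|N /ltW N1 x [x0 x1 xS]]; first exact: num_real.
  apply: le_trans N1; rewrite [`|x|]mx_normrE; apply: bigmax_le => // -[i j] _ /=.
  rewrite (ord1 i) ger0_norm //; case: (unliftP ord0 j) => [k ->|-> //].
  by rewrite -xS (bigD1 k) //= lerDl sumr_ge0.
have -> : prism = (\bigcap_i [set x | 0 <= x 0 i]) `&` [set x | x 0 ord0 <= 1]
    `&` [set x | \sum_k x 0 (lift ord0 k) = 1].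
  apply/seteqP; split=> x /=; first by case=> x0 x1 xS; do 2!split=> //; move=> i _; exact: x0.
  by case=> -[x0 x1] xS; split=> // i; exact: (x0 i I).
apply: closedI; first apply: closedI.
- apply: closed_bigI => i _.
  exact: (closed_comp (fun x _ => cc i x) (@closed_ge R 0)).
- exact: (closed_comp (fun x _ => cc ord0 x) (@closed_le R 1)).
have cS : continuous (fun x : 'rV[R]_mh.+1 => \sum_k x 0 (lift ord0 k)).
  by apply: continuous_big => [|k _]; [exact: add_continuous|exact: cc].
exact: (closed_comp (fun x _ => cS x) (@closed_eq R 1)).
Qed.

Lemma uniform_limit_within (T : topologicalType) (S : set T) (F : T -> R) :
  (forall e, 0 < e -> exists2 G : T -> R, continuous G &
     forall x, S x -> `|F x - G x| <= e) ->
  {within S, continuous F}.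
Proof.
move=> FG; apply/subspace_continuousP => x Sx; apply/cvgrPdist_le => e e0.
have e3 : 0 < e / 3 by rewrite divr_gt0.
have [G cG hG] := FG _ e3.
have := cG x => /cvgrPdist_le /(_ _ e3) nG.
near=> y.
have Sy : S y by near: y; apply: withinT; exact: nbhs_filter.
have Gy : `|G x - G y| <= e / 3 by near: y; apply: cvg_within; exact: nG.
have -> : F x - F y = (F x - G x) + (G x - G y) - (F y - G y) by ring.
rewrite (le_trans (ler_normB _ _)) // (le_trans (lerD (ler_normD _ _) (lexx _))) //.
have := hG x Sx; have := hG y Sy; move: Gy.
by set a := `|_|; set b := `|_|; set c := `|_|; move: a b c => a b c *; lra.
Unshelve. all: by end_near. Qed.

End ConvexHull.

Arguments prism {R mh}.

(** * Rows times matrices times columns *)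

Section Sandwich.
Variables (R : realType) (n : nat).
Local Notation C := R[i].
Local Notation re := (@complex.Re R).

Definition sandwich (rho : 'rV[C]_n.+1) (c : 'cV[C]_n.+1) (X : 'M[C]_n.+1) : C :=
  (rho *m X *m c) 0 0.

Lemma sandwichD rho c X Y : sandwich rho c (X + Y) = sandwich rho c X + sandwich rho c Y.
Proof. by rewrite /sandwich mulmxDr mulmxDl mxE. Qed.

Lemma sandwichZ rho c a X : sandwich rho c (a *: X) = a * sandwich rho c X.
Proof. by rewrite /sandwich -scalemxAr -scalemxAl mxE. Qed.

Lemma sandwichB rho c X Y : sandwich rho c (X - Y) = sandwich rho c X - sandwich rho c Y.
Proof. by rewrite sandwichD -scaleN1r sandwichZ mulN1r. Qed.

Lemma sandwich_le rho c : exists2 L : R, 0 < L & forall (X : 'M[C]_n.+1) (e : R), 0 <= e ->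
  (forall i j, `|X i j| <= e%:C) -> `|sandwich rho c X| <= (L * e)%:C.
Proof.
pose S : C := \sum_j (\sum_i `|rho 0 i|) * `|c j 0|.
have S0 : 0 <= S.
  by apply: sumr_ge0 => j _; apply: mulr_ge0 => //; apply: sumr_ge0.
have [L LE] : exists L : R, S = L%:C.
  by exists (re S); rewrite RRe_real // ger0_real.
have L0 : 0 <= L by rewrite -ler0c -LE.
exists (L + 1) => [|X e e0 Xe]; first by rewrite ltr_wpDl.
apply: (@le_trans _ _ (L * e)%:C); last by rewrite lecR ler_wpM2r // lerDl.
have -> : (L * e)%:C = S * e%:C by rewrite rmorphM LE.
rewrite /sandwich mxE (le_trans (ler_norm_sum _ _ _)) // mulr_suml.
apply: ler_sum => j _; rewrite normrM mulrAC ler_wpM2r // mxE.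
rewrite (le_trans (ler_norm_sum _ _ _)) // mulr_suml.
by apply: ler_sum => i _; rewrite normrM ler_wpM2l.
Qed.

Variable A : 'M[C]_n.+1.

Definition mx_homothety (s : R) (mu : C) : 'M[C]_n.+1 :=
  ((1 - s%:C) * mu)%:M + s%:C *: A.

(** This turns the bound of [divided_difference_le] into one on values at the
    matrices [(1 - s) mu 1 + s A]. *)
Lemma horner_mx_homothety (q : {poly C}) mu s :
  horner_mx A (q \Po homothety mu s) = horner_mx (mx_homothety s mu) q.
Proof.
have hE : horner_mx A (homothety mu s) = mx_homothety s mu.
  by rewrite /homothety rmorphD /= horner_mx_C horner_mxZ horner_mx_X.
elim/poly_ind: q => [|q c IH]; first by rewrite comp_poly0 !rmorph0.
rewrite comp_polyD comp_polyM comp_polyX comp_polyC rmorphD rmorphM /= IH hE.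
by rewrite rmorphD rmorphM /= !horner_mx_C horner_mx_X.
Qed.

Lemma sumnorm_mx_homothety_le s (mu : C) (r : R) : 0 <= s <= 1 -> `|mu| <= r%:C ->
  sumnorm (mx_homothety s mu) <= n.+1%:R * r%:C + sumnorm A.
Proof.
move=> /andP[s0 s1] mur; rewrite /mx_homothety (le_trans (sumnormD _ _)) //.
rewrite -scalemx1 !sumnormZ sumnorm1 mulrC lerD //.
  rewrite ler_wpM2l // normrM.
  have -> : 1 - s%:C = (1 - s)%:C :> C by rewrite rmorphB rmorph1.
  rewrite normc_real (ger0_norm (_ : 0 <= 1 - s)) ?subr_ge0 // (le_trans _ mur) // ler_piMl //.
  by rewrite -[X in _ <= X](rmorph1 (real_complex R)) lecR gerBl.
rewrite normc_real (ger0_norm s0) ler_piMl ?sumnorm_ge0 //.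
by rewrite -[X in _ <= X](rmorph1 (real_complex R)) lecR.
Qed.

Lemma ccontinuous_mx_homothety (T : topologicalType) (f : T -> R) (g : T -> C)
    (q : {poly C}) rho c :
  continuous f -> ccontinuous g ->
  ccontinuous (fun x => sandwich rho c (horner_mx (mx_homothety (f x) (g x)) q)).
Proof.
move=> cf cg.
have cfC : ccontinuous (fun x => (f x)%:C).
  exact: ccontinuous_ofreal.
have cs i j : ccontinuous (fun x => mx_homothety (f x) (g x) i j).
  have -> : (fun x => mx_homothety (f x) (g x) i j) =
      (fun x => ((1 + -1 * (f x)%:C) * g x) * (i == j)%:R + (f x)%:C * A i j).
    by apply/funext => x; rewrite !mxE mulN1r mulr_natr.
  apply: ccontinuousD; last by apply: ccontinuousM cfC _; exact: ccontinuous_cst.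
  apply: ccontinuousM; last exact: ccontinuous_cst.
  apply: ccontinuousM cg; apply: ccontinuousD; first exact: ccontinuous_cst.
  by apply: ccontinuousM cfC; exact: ccontinuous_cst.
have cq i j : ccontinuous (fun x => horner_mx (mx_homothety (f x) (g x)) q i j).
  elim/poly_ind: q i j => [|q a IH] i j.
    rewrite (_ : (fun x => _) = (fun=> 0)); first exact: ccontinuous_cst.
    by apply/funext => x; rewrite rmorph0 mxE.
  rewrite (_ : (fun x => _) = (fun x => \sum_k
      horner_mx (mx_homothety (f x) (g x)) q i k * mx_homothety (f x) (g x) k j + a%:M i j)).
    apply: ccontinuousD; last exact: ccontinuous_cst.
    apply: (ccontinuous_sum _ (F := fun k x =>
      horner_mx (mx_homothety (f x) (g x)) q i k * mx_homothety (f x) (g x) k j)) => k _.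
    exact: ccontinuousM.
  apply/funext => x; rewrite rmorphD rmorphM /= horner_mx_X horner_mx_C.
  by rewrite mxE [X in X + _]mxE.
rewrite (_ : (fun x => _) = (fun x => \sum_j (\sum_i rho 0 i *
  horner_mx (mx_homothety (f x) (g x)) q i j) * c j 0)); last first.
  by apply/funext => x; rewrite /sandwich mxE; apply: eq_bigr => j _; rewrite mxE.
apply: (ccontinuous_sum _ (F := fun j x => (\sum_i rho 0 i *
  horner_mx (mx_homothety (f x) (g x)) q i j) * c j 0)) => j _.
apply: ccontinuousM; last exact: ccontinuous_cst.
apply: (ccontinuous_sum _ (F := fun i x => rho 0 i *
  horner_mx (mx_homothety (f x) (g x)) q i j)) => i _.
by apply: ccontinuousM => //; exact: ccontinuous_cst.
Qed.

Lemma continuous_normc (T : topologicalType) (h : T -> C) :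
  ccontinuous h -> continuous (fun x => re `|h x|).
Proof.
move=> [h1 h2] x.
rewrite (_ : (fun x => _) =
  @Num.sqrt R \o ((re \o h) * (re \o h) + ((@complex.Im R) \o h) * ((@complex.Im R) \o h))).
  apply: continuous_comp; last exact: sqrt_continuous.
  by apply: continuousD; apply: continuousM; [exact: h1|exact: h1|exact: h2|exact: h2].
by apply/funext => y; rewrite normc_def /= !fctE /= !expr2.
Qed.

End Sandwich.

Definition sandwich_horner (R : realType) (n : nat) (A : 'M[R[i]]_n.+1) rho c
  (q : {poly R[i]}) : (R[i])^o := sandwich rho c (horner_mx A q).

Fact sandwich_horner_linear (R : realType) (n : nat) (A : 'M[R[i]]_n.+1) rho c :
  linear (sandwich_horner A rho c).
Proof.
by move=> a p q; rewrite /sandwich_horner rmorphD /= horner_mxZ sandwichD sandwichZ.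
Qed.

HB.instance Definition _ (R : realType) (n : nat) (A : 'M[R[i]]_n.+1) rho c :=
  GRing.isLinear.Build R[i] {poly R[i]} (R[i])^o *:%R (sandwich_horner A rho c)
    (sandwich_horner_linear A rho c).

(** All matrices between [r] and [u] are polynomials in [A] or inverses of such,
    so they commute and the factors [v1], [v2] cancel the inverse. *)
Lemma sandwich_commute (R : realType) n (A : 'M[R[i]]_n.+1) (r : 'rV_n.+1) (u : 'cV_n.+1)
    (v1 v2 w q : {poly R[i]}) :
  horner_mx A (v2 * v1) \in unitmx ->
  sandwich (r *m horner_mx A v2 *m horner_mx A w *m
                invmx (horner_mx A (v2 * v1))) (horner_mx A v1 *m u) (horner_mx A q)
  = (r *m (horner_mx A w *m (horner_mx A q *m u))) 0 0.
Proof.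
move=> vu; rewrite /sandwich; congr (fun_of_matrix _ 0 0).
have vC : GRing.comm (horner_mx A (q * v1)) (horner_mx A (v2 * v1))^-1.
  by apply: commrV; rewrite /GRing.comm -!rmorphM mulrC.
have key : horner_mx A v2 * horner_mx A w * (horner_mx A (v2 * v1))^-1 *
    horner_mx A (q * v1) = horner_mx A w * horner_mx A q.
  rewrite -mulrA -vC -!rmorphM mulrA -!rmorphM.
  rewrite (_ : v2 * w * (q * v1) = w * q * (v2 * v1)); last by ring.
  by rewrite (rmorphM _ _ (v2 * v1)) mulrK // -topredE.
have qv : horner_mx A (q * v1) = horner_mx A q *m horner_mx A v1 by exact: rmorphM.
have key' : horner_mx A v2 *m horner_mx A w *m invmx (horner_mx A (v2 * v1)) *m
    horner_mx A (q * v1) = horner_mx A w *m horner_mx A q by exact: key.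
rewrite -!mulmxA (mulmxA (horner_mx A q)) -qv; congr (r *m _).
by have := congr1 (mulmx^~ u) key'; rewrite -!mulmxA.
Qed.

Lemma sandwich_mxfun_approx (R : realType) n (rho : 'rV[R[i]]_n.+1) c (f : R[i] -> R[i]) P
    (S : set ('M[R[i]]_n.+1)) (bd e : R) :
    (forall r, circle_continuous r f) -> poly_approx f P -> 0 < e ->
    (forall B, S B -> sumnorm B <= bd%:C) ->
  exists K0, forall K, (K0 <= K)%N -> forall B, S B ->
    `|sandwich rho c (mxfun f B) - sandwich rho c (horner_mx B (P K))| <= e%:C.
Proof.
move=> cf fP e0 Sbd; have [L L0 hL] := sandwich_le rho c.
have eL : 0 < e / L by rewrite divr_gt0.
have [K0 h] := mxfun_approx n bd cf fP eL; exists K0 => K k B SB.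
rewrite -sandwichB; have -> : e = L * (e / L) by rewrite mulrC divfK ?gt_eqF.
apply: hL; first exact: ltW.
by move=> i j; rewrite !mxE; have := h K k B (Sbd B SB) i j; rewrite !mxE.
Qed.

Lemma sandwich_mxfun_approx_at (R : realType) n (B : 'M[R[i]]_n.+1) rho c f P (e : R) :
    (forall r, circle_continuous r f) -> poly_approx f P -> 0 < e ->
  exists K0, forall K, (K0 <= K)%N ->
    `|sandwich rho c (mxfun f B) - sandwich rho c (horner_mx B (P K))| <= e%:C.
Proof.
move=> cf fP e0; have [r rE] := norm_is_real (sumnorm B).
have Br X : [set B] X -> sumnorm X <= r%:C.
  by move=> ->; rewrite -rE ger0_norm ?sumnorm_ge0.
have [K0 h] := sandwich_mxfun_approx rho c cf fP e0 Br.
by exists K0 => K k; apply: h.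
Qed.

Lemma circle_continuous_expt (R : realType) (t : R) (q : {poly R[i]}) r :
  circle_continuous r (fun z => q.[z] * expt t z).
Proof.
apply: ccontinuousM; first by apply: ccontinuous_horner; exact: ccontinuous_circle_point.
apply: ccontinuous_cexp; apply: ccontinuousM (ccontinuous_circle_point _) _.
exact: ccontinuous_cst.
Qed.

(** * The reduced-order model *)

Section Reduction.
Variable R : realType.
Local Notation C := R[i].

Lemma adjointM p q s (A : 'M[C]_(p, q)) (B : 'M[C]_(q, s)) :
  (A *m B)^t* = B^t* *m A^t*.
Proof. by rewrite trmx_mul map_mxM. Qed.

Lemma adjointK p q (A : 'M[C]_(p, q)) : (A^t*)^t* = A.
Proof. by apply/matrixP => i j; rewrite !mxE conjCK. Qed.

Lemma horner_mx_adjoint n (A : 'M[C]_n.+1) (q : {poly C}) :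
  (horner_mx A q)^t* = horner_mx (A^t*) (map_poly Num.conj q).
Proof.
elim/poly_ind: q => [|q c IH].
  by rewrite !rmorph0; apply/matrixP => i j; rewrite !mxE conjC0.
have -> : horner_mx A (q * 'X + c%:P) = horner_mx A q *m A + c%:M.
  by rewrite rmorphD rmorphM /= horner_mx_X horner_mx_C.
rewrite linearD /= map_mxD adjointM IH tr_scalar_mx map_scalar_mx.
rewrite rmorphD /= map_polyC /= rmorphD /= horner_mx_C; congr (_ + _).
by rewrite [map_poly _ (q * 'X)]rmorphM /= map_polyX mulrC rmorphM /= horner_mx_X.
Qed.

Lemma pole_poly_unitmx n m (A : 'M[C]_n.+1) (lam : 'I_m -> C) kap :
  (forall k, (lam k)%:M - A \in unitmx) ->
  horner_mx A (pole_poly lam kap) \in unitmx.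
Proof.
move=> lamA; rewrite /pole_poly; elim/big_ind: _ => [|p q pu qu|k _].
- by rewrite rmorph1 unitmx1.
- by rewrite rmorphM unitmx_mul pu qu.
elim: (kap k) => [|j IH]; first by rewrite expr0 rmorph1 unitmx1.
rewrite exprS rmorphM unitmx_mul IH andbT rmorphB /= horner_mx_X horner_mx_C.
by rewrite -opprB -scaleN1r unitmxZ ?lamA // unitrN unitr1.
Qed.

Lemma map_pole_poly m (lam : 'I_m -> C) kap :
  map_poly Num.conj (pole_poly lam kap) =
  pole_poly (fun k => (lam k)^*%C) kap.
Proof.
rewrite /pole_poly rmorph_prod; apply: eq_bigr => k _.
by rewrite rmorphXn /= map_polyXsubC.
Qed.

Lemma limg_isometryP n nh (V : 'M[C]_(n, nh)) (W : 'M[C]_(nh, n)) (x : 'cV[C]_n) :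
  W *m V = 1%:M -> x \in limg (linfun (mulmx V : 'cV_nh -> 'cV_n)) ->
  V *m W *m x = x.
Proof.
move=> WV /memv_imgP[w _ ->]; rewrite lfunE /= mulmxA -(mulmxA V) WV.
by rewrite mulmx1.
Qed.

Lemma dim_limg_isometry n nh (V : 'M[C]_(n, nh)) (W : 'M[C]_(nh, n)) :
  W *m V = 1%:M -> \dim (limg (linfun (mulmx V : 'cV_nh -> 'cV_n))) = nh.
Proof.
move=> WV; rewrite limg_dim_eq; first by rewrite dimvf /= /dim /= muln1.
apply/eqP; rewrite -subv0; apply/subvP => x; rewrite memv_cap memv_ker lfunE /=.
by rewrite memv0 => /andP[_ /eqP Vx0]; rewrite -[x]mul1mx -WV -mulmxA Vx0 mulmx0.
Qed.

Variables (n nh m : nat) (A : 'M[C]_n.+1) (b d : 'cV[C]_n.+1).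
Variables (lam : 'I_m -> C) (kap0 chi0 : nat) (kap chi : 'I_m -> nat).
Variable V : 'M[C]_(n.+1, nh.+1).
Hypothesis lam_A : forall k, ~~ eigenvalue A (lam k).
Hypothesis V_orth : V^t* *m V = 1%:M.
Hypothesis V_basis :
  basis_of (limg (linfun (mulmx V : 'cV[C]_nh.+1 -> 'cV[C]_n.+1)))
           (krylov_vectors A b d lam kap0 chi0 kap chi).

Let Vimg := limg (linfun (mulmx V : 'cV[C]_nh.+1 -> 'cV[C]_n.+1)).
Let B_part := krylov_family A b lam kap0 kap.
Let D_part := krylov_family (A^t*) d (fun k => (lam k)^*%C) chi0 chi.

Lemma krylov_vectors_perm :
  perm_eq (krylov_vectors A b d lam kap0 chi0 kap chi) (B_part ++ D_part).
Proof.
rewrite /krylov_vectors /B_part /D_part /krylov_family -!catA perm_cat2l.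
by rewrite perm_catCA.
Qed.

Let lamA_unit k : (lam k)%:M - A \in unitmx.
Proof. exact: resolvent_unitmx. Qed.

Let lamA_adj_unit k : ((lam k)^*%C)%:M - A^t* \in unitmx.
Proof.
have -> : ((lam k)^*%C)%:M - A^t* = ((lam k)%:M - A)^t*.
  by rewrite linearB /= map_mxB tr_scalar_mx map_scalar_mx.
by rewrite map_unitmx unitmx_tr.
Qed.

Let free_parts : free (B_part ++ D_part).
Proof. by rewrite -(perm_free krylov_vectors_perm) (basis_free V_basis). Qed.

Let parts_sub : {subset B_part ++ D_part <= Vimg}.
Proof.
by move=> x; rewrite -(perm_mem krylov_vectors_perm) => /(basis_mem V_basis).
Qed.

Lemma reduced_order : nh.+1 = ((kap0 + \sum_k kap k) + (chi0 + \sum_k chi k))%N.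
Proof.
case/andP: V_basis => /eqP spanV /eqP sizeV.
have : size (krylov_vectors A b d lam kap0 chi0 kap chi) = nh.+1.
  by rewrite -sizeV spanV (dim_limg_isometry V_orth).
rewrite (perm_size krylov_vectors_perm) => <-.
by rewrite size_cat !size_krylov_family.
Qed.

(** The vector [v1(A)^-1 b], whose Krylov space under [A] carries the moments. *)
Definition column_seed := invmx (horner_mx A (pole_poly lam kap)) *m b.
(** The row [d^H v2(A)^-1], written through the adjoint so that
    [rational_krylov_span] applies to it. *)
Definition row_seed :=
  (invmx (horner_mx (A^t*) (pole_poly (fun k => (lam k)^*%C) chi)) *m d)^t*.

Lemma column_seedE : horner_mx A (pole_poly lam kap) *m column_seed = b.
Proof. by rewrite mulmxA mulmxV ?mul1mx // pole_poly_unitmx. Qed.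

Lemma row_seedE : row_seed *m horner_mx A (pole_poly lam chi) = d^t*.
Proof.
rewrite -[horner_mx A _]adjointK horner_mx_adjoint map_pole_poly -adjointM mulmxA.
by rewrite mulmxV ?mul1mx // pole_poly_unitmx.
Qed.

Lemma column_seed_krylov j : (j < kap0 + \sum_k kap k)%N ->
  V *m V^t* *m (A ^+ j *m column_seed) = A ^+ j *m column_seed.
Proof.
move=> jN; apply: limg_isometryP V_orth _.
apply: (rational_krylov_span lamA_unit _ _ column_seedE jN).
  exact: catl_free free_parts.
by move=> x xB; apply: parts_sub; rewrite mem_cat xB.
Qed.

Lemma row_seed_krylov j : (j < chi0 + \sum_k chi k)%N ->
  row_seed *m A ^+ j *m (V *m V^t*) = row_seed *m A ^+ j.
Proof.
move=> jN.
have -> : row_seed *m A ^+ j = ((A^t*) ^+ j *m row_seed^t*)^t*.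
  rewrite adjointM adjointK; congr (_ *m _).
  have := horner_mx_adjoint (A^t*) 'X^j; rewrite map_polyXn !rmorphXn /= !horner_mx_X.
  by rewrite adjointK => ->.
have PP : V *m V^t* = (V *m V^t*)^t* by rewrite adjointM adjointK.
rewrite PP -adjointM; congr (_^t*).
apply: limg_isometryP V_orth _.
rewrite /row_seed adjointK.
apply: (rational_krylov_span (lam := fun k => (lam k)^*%C) lamA_adj_unit _ _ _ jN).
- exact: catr_free free_parts.
- by move=> x xB; apply: parts_sub; rewrite mem_cat xB orbT.
by rewrite mulmxA mulmxV ?mul1mx // pole_poly_unitmx.
Qed.

Lemma krylov_reduction_error (Ah := V^t* *m A *m V) (T : {poly C})
    (v := pole_poly lam chi * pole_poly lam kap) :
  sandwich (d^t*) b (horner_mx A T) -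
    sandwich ((V^t* *m d)^t*) (V^t* *m b) (horner_mx Ah T) =
  sandwich_horner A
    (d^t* *m horner_mx A (char_poly Ah) *m invmx (horner_mx A v)) b
    ((v * T) %/ char_poly Ah).
Proof.
have vu : horner_mx A v \in unitmx by rewrite rmorphM unitmx_mul !pole_poly_unitmx.
rewrite /sandwich_horner -{2}row_seedE -{3}column_seedE sandwich_commute //.
have := krylov_error (v1 := pole_poly lam kap) (v2 := pole_poly lam chi)
  column_seed_krylov row_seed_krylov T reduced_order.
rewrite !size_pole_poly !ltnS !leq_addl => /(_ isT isT).
rewrite -/Ah -/v => <-.
rewrite /sandwich adjointM adjointK -row_seedE -column_seedE [RHS]mxE [X in _ = _ + X]mxE.
by rewrite -!mulmxA.
Qed.

End Reduction.

(** * The spectrum of the reduced matrix and the maximum *)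

Section Main.
Variable R : realType.
Local Notation C := R[i].
Local Notation re := (@complex.Re R).

Lemma char_poly_spectrum nh mh (Ah : 'M[C]_nh.+1) (muh : 'I_mh -> C) (wh : 'I_mh -> nat) :
    injective muh -> (forall z, eigenvalue Ah z <-> exists k, muh k = z) ->
    (forall k, wh k = mup (muh k) (char_poly Ah)) ->
  exists mus : seq C, [/\ size mus = nh.+1,
    forall z, z \in mus -> exists k, muh k = z,
    char_poly Ah = \prod_(z <- mus) ('X - z%:P) &
    char_poly Ah = \prod_k ('X - (muh k)%:P) ^+ wh k].
Proof.
move=> inj spec whE.
have [mus musE] := closed_field_poly_normal (char_poly Ah).
rewrite (monicP (char_poly_monic Ah)) scale1r in musE.
have rootE z : (z \in mus) = eigenvalue Ah z.
  by rewrite eigenvalue_root_char musE root_prod_XsubC.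
exists mus; split=> //.
- by have := size_char_poly Ah; rewrite musE size_prod_XsubC => -[].
- by move=> z; rewrite rootE => /spec.
rewrite {1}musE -(prodr_undup_exp_count mus predT).
rewrite (perm_big [seq muh k | k <- index_enum 'I_mh]) /=.
  by rewrite big_map; apply: eq_bigr => k _; rewrite whE musE mu_prod_XsubC.
apply: uniq_perm; rewrite ?undup_uniq ?map_inj_uniq ?index_enum_uniq // => z.
rewrite mem_undup rootE; apply/idP/mapP => [/spec[k <-]|[k _ ->]].
  by exists k => //; rewrite mem_index_enum.
by apply/spec; exists k.
Qed.

(** Composed with the parametrisation of [0, 1] times the hull by the compact set
    [prism], the modulus of [F] is a uniform limit of continuous functions, so it
    attains its maximum. *)
Lemma sandwich_max n mh (mu : 'I_mh -> C) (A : 'M[C]_n.+1) rho c (F : R -> C -> C)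
    (k0 : 'I_mh) :
    (forall e : R, 0 < e -> exists q : {poly C}, forall (s : R) m, 0 <= s <= 1 ->
       convex_hull (range mu) m ->
       `|F s m - sandwich rho c (horner_mx (mx_homothety A s m) q)| <= e%:C) ->
  exists s0 m0, [/\ 0 <= s0 <= 1, convex_hull (range mu) m0 &
    forall (s : R) m, 0 <= s <= 1 -> convex_hull (range mu) m -> `|F s m| <= `|F s0 m0|].
Proof.
move=> Fq.
have prismP x : prism x -> 0 <= x 0 ord0 <= 1 /\
    convex_hull (range mu) (barycenter mu x).
  move=> [x0 x1 xS]; rewrite x0 x1; split=> //.
  exact: (convex_hull_combination (a := fun k => x 0 (lift ord0 k))).
have toprism (s : R) m : 0 <= s <= 1 -> convex_hull (range mu) m ->
    exists2 x, prism x & x 0 ord0 = s /\ barycenter mu x = m.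
  move=> /andP[s0 s1] /convex_hull_subset_combination[a [a0 a1 ->]].
  pose x := \row_j (if unlift ord0 j is Some k then a k else s) : 'rV[R]_mh.+1.
  have xl k : x 0 (lift ord0 k) = a k by rewrite mxE liftK.
  have x0 : x 0 ord0 = s by rewrite mxE unlift_none.
  exists x; last by split=> //; apply: eq_bigr => k _; rewrite xl.
  split; rewrite ?x0 //; last by under eq_bigr do rewrite xl.
  by move=> j; rewrite mxE; case: unlift.
pose G (x : 'rV[R]_mh.+1) := re `|F (x 0 ord0) (barycenter mu x)|.
have GE x : (G x)%:C = `|F (x 0 ord0) (barycenter mu x)|.
  by rewrite /G RRe_real ?normr_real.
have cG : {within prism, continuous G}.
  apply: uniform_limit_within => e e0; have [q hq] := Fq e e0.
  pose f (x : 'rV[R]_mh.+1) := sandwich rho c (horner_mx (mx_homothety A (x 0 ord0) (barycenter mu x)) q).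
  exists (fun x => re `|f x|).
    apply: continuous_normc.
    apply: (ccontinuous_mx_homothety A (f := fun x : 'rV[R]_mh.+1 => x 0 ord0)).
      exact: coord_continuous.
    apply: (ccontinuous_sum _ (F := fun k (x : 'rV[R]_mh.+1) =>
      (x 0 (lift ord0 k))%:C * mu k)) => k _.
    apply: ccontinuousM; last exact: ccontinuous_cst.
    by apply: ccontinuous_ofreal; exact: coord_continuous.
  move=> x /prismP[x01 xh]; rewrite -lecR -normc_real rmorphB.
  rewrite [X in X - _]GE [X in _ - X]RRe_real ?normr_real //.
  exact: le_trans (ler_dist_dist _ _) (hq _ _ x01 xh).
have [|y yp ymax] := @EVT_max_rV R mh.+1 G prism _ (@prism_compact R mh) cG.
  have [|z pz _] := toprism 0 (mu k0) _ (convex_hull_range k0).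
    by rewrite lexx ler01.
  by exists z.
rewrite in_setE in yp; have [y01 yh] := prismP _ yp.
exists (y 0 ord0), (barycenter mu y); split=> // s m s01 mh'.
have [z pz [<- <-]] := toprism s m s01 mh'.
by rewrite -!GE lecR ymax // in_setE.
Qed.

End Main.

(** * The error bound *)

Theorem theorem22 (R : realType) (n nh m mh : nat)
    (A : 'M[R[i]]_n) (b d : 'cV[R[i]]_n)
    (lam : 'I_m -> R[i]) (kap0 chi0 : nat) (kap chi : 'I_m -> nat)
    (V : 'M[R[i]]_(n, nh)) (Ah : 'M[R[i]]_nh) (bh dh : 'cV[R[i]]_nh)
    (muh : 'I_mh -> R[i]) (wh : 'I_mh -> nat) (v Omega : R[i] -> R[i])
    (nh_gt0 : (0 < nh)%N)
    (lam_A : forall k, ~~ eigenvalue A (lam k))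
    (V_orth : V^t* *m V = 1%:M)
    (V_basis : basis_of (limg (linfun (mulmx V : 'cV[R[i]]_nh -> 'cV[R[i]]_n)))
                 (krylov_vectors A b d lam kap0 chi0 kap chi))
    (AhE : Ah = V^t* *m A *m V) (bhE : bh = V^t* *m b) (dhE : dh = V^t* *m d)
    (muh_inj : injective muh)
    (muh_spec : forall z, eigenvalue Ah z <-> exists k, muh k = z)
    (whE : forall k, wh k = mup (muh k) (char_poly Ah))
    (lam_Ah : forall k, ~~ eigenvalue Ah (lam k))
    (vE : v = fun z => \prod_k (z - lam k) ^+ (kap k + chi k))
    (OmegaE : Omega = fun z => \prod_k (z - muh k) ^+ wh k)
    (t : R) :
  exists2 M : R[i],
    is_max
      [set `| (d^t* *m
               (mxfun Omega A *m invmx (mxfun v A) *m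
                ((nh`!%:R)^-1 *:
                 mxfun (derive1n nh (fun z => v z * expt t z : R[i]^o))
                   (((1 - s%:C) * mu)%:M + s%:C *: A))) *m b) 0 0 |
        | s in `[0%R, 1%R] & mu in convex_hull (range muh)] M &
    `| (d^t* *m mxfun (expt t) A *m b) 0 0
       - (dh^t* *m mxfun (expt t) Ah *m bh) 0 0 | <= M.
Proof.
case: nh V Ah bh dh nh_gt0 V_orth V_basis AhE bhE dhE muh_spec whE lam_Ah => // {}nh.
move=> V Ah bh dh _.
(* An isometry from a nonzero space rules out n = 0. *)
case: n A b d lam_A V => [|{}n] A b d lam_A V V_orth V_basis AhE bhE dhE muh_spec whE lam_Ah.
  have := congr1 (fun X : 'M[R[i]]_nh.+1 => X 0 0) V_orth.
  by rewrite !mxE big_ord0 eqxx => /eqP; rewrite eq_sym oner_eq0.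
have [mus [size_mus mus_spec musE OmE]] :=
  char_poly_spectrum muh_inj muh_spec whE.
have [k0 _] : exists k0 : 'I_mh, True.
  by case: mus size_mus mus_spec {musE} => // z mus _ /(_ z (mem_head _ _)) [k _]; exists k.
pose hull := convex_hull (range muh).
pose v1 := pole_poly lam kap; pose v2 := pole_poly lam chi.
pose vp := v2 * v1; pose chiA := char_poly Ah.
have vpE : v = horner vp.
  rewrite vE /vp /v1 /v2 /pole_poly -big_split /=; apply/funext => z.
  rewrite horner_prod; apply: eq_bigr => k _.
  by rewrite -exprD addnC horner_exp hornerXsubC.
have OmegaEp : Omega = horner chiA.
  rewrite OmegaE /chiA OmE; apply/funext => z; rewrite horner_prod.
  by apply: eq_bigr => k _; rewrite horner_exp hornerXsubC.
pose rho := d^t* *m horner_mx A chiA *m invmx (horner_mx A vp).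
pose Q := iter nh.+1 (exp_deriv t) vp.
pose G z := Q.[z] * expt t z.
have GE : derive1n nh.+1 (fun z => v z * expt t z : R[i]^o) = G.
  by rewrite vpE derive1n_poly_expt.
have cExp rad : circle_continuous rad (expt t).
  have := circle_continuous_expt t 1%:P rad; congr ccontinuous; apply/funext => x.
  by rewrite hornerC mul1r.
pose P K := (vp * expt_poly t K)^`(nh.+1).
pose F s mu := sandwich rho b (mxfun G (mx_homothety A s mu)).
have [r0 hull_bd] := convex_hull_bounded muh.
have [r1 r1E] := norm_is_real (sumnorm A).
rewrite ger0_norm ?sumnorm_ge0 // in r1E.
pose S := [set B | exists2 s : R, 0 <= s <= 1 & exists2 mu, hull mu & B = mx_homothety A s mu].
have S_bd B : S B -> sumnorm B <= (n.+1%:R * r0 + r1)%:C.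
  move=> [s s01 [mu hmu ->]].
  rewrite (le_trans (sumnorm_mx_homothety_le A s01 (hull_bd mu hmu))) //.
  by rewrite rmorphD rmorphM rmorph_nat r1E.
have F_approx e : 0 < e -> exists K0, forall K, (K0 <= K)%N -> forall s mu,
    0 <= s <= 1 -> hull mu ->
    `|F s mu - sandwich rho b (horner_mx (mx_homothety A s mu) (P K))| <= e%:C.
  move=> e0; have [K0 h] := sandwich_mxfun_approx rho b
    (circle_continuous_expt t Q) (poly_approx_derivn t nh.+1 vp) e0 S_bd.
  by exists K0 => K k s mu s01 hmu; apply: h k _ _; exists s => //; exists mu.
have [s0 [m0 [s01 hm0 Fmax]]] : exists s0 m0, [/\ 0 <= s0 <= 1, hull m0 &
    forall s mu, 0 <= s <= 1 -> hull mu -> `|F s mu| <= `|F s0 m0|].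
  apply: (sandwich_max k0) => e e0.
  have [K0 h] := F_approx e e0; exists (P K0) => s mu s01 hmu; exact: h.
have [M0 M0E] := norm_is_real (F s0 m0).
pose N : R := nh.+1`!%:R; have N0 : 0 < N by rewrite ltr0n fact_gt0.
have valE X : (d^t* *m (mxfun Omega A *m invmx (mxfun v A) *m
    ((nh.+1`!%:R)^-1 *: X)) *m b) 0 0 = N^-1%:C * sandwich rho b X.
  rewrite OmegaEp vpE !mxfun_poly /sandwich /rho -!scalemxAr -scalemxAl mxE !mulmxA.
  by rewrite fmorphV rmorph_nat.
have normN : `|N^-1%:C| = N^-1%:C :> R[i].
  by rewrite normc_real ger0_norm // invr_ge0 ltW.
exists (N^-1 * M0)%:C.
  split.
    exists s0; first by rewrite /= in_itv.
    exists m0 => //; rewrite GE valE normrM normN.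
    by rewrite -[mxfun G _]/(mxfun G (mx_homothety A s0 m0)) -/(F s0 m0) M0E rmorphM.
  move=> _ [s s01' [mu hmu <-]]; rewrite GE valE normrM normN.
  rewrite (_ : (N^-1 * M0)%:C = N^-1%:C * `|F s0 m0|); last by rewrite rmorphM M0E.
  have {}s01' : 0 <= s <= 1 by move: s01'; rewrite /= in_itv.
  apply: ler_wpM2l; first by rewrite ler0c invr_ge0 (ltW N0).
  exact: (Fmax s mu s01' hmu).
set D := _ - _; have [x xE] := norm_is_real D; rewrite xE lecR.
apply/ler_addgt0Pr => e e0.
have e3 : 0 < e / 3 by rewrite divr_gt0.
have [K1 h1] := sandwich_mxfun_approx_at A (d^t*) b cExp (poly_approx_expt t) e3.
have [K2 h2] := sandwich_mxfun_approx_at Ah (dh^t*) bh cExp (poly_approx_expt t) e3.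
(* The third part of the error is divided by N = nh! at the end. *)
have Ne : 0 < N * (e / 3) by rewrite mulr_gt0.
have [K3 h3] := F_approx _ Ne.
pose K := maxn K1 (maxn K2 K3).
have {}h1 := h1 K (leq_maxl _ _).
have {}h2 := h2 K (leq_trans (leq_maxl _ _) (leq_maxr _ _)).
have {}h3 := h3 K (leq_trans (leq_maxr _ _) (leq_maxr _ _)).
pose T := expt_poly t K.
have errE : sandwich (d^t*) b (horner_mx A T) - sandwich (dh^t*) bh (horner_mx Ah T)
    = sandwich_horner A rho b ((vp * T) %/ chiA).
  rewrite dhE bhE /rho /chiA AhE; exact: (krylov_reduction_error lam_A V_orth V_basis).
have dd : `|sandwich_horner A rho b ((vp * T) %/ chiA) : R[i]| <= ((M0 + N * (e / 3)) / N)%:C.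
  rewrite /chiA musE /N -size_mus.
  apply: (divided_difference_le (Psi := sandwich_horner A rho b) (K := hull)).
  - exact: convex_hull_segment.
  - by exists (muh k0); exact: convex_hull_range.
  - by move=> z /mus_spec[k <-]; exact: convex_hull_range.
  move=> s mu s01' hmu; rewrite size_mus.
  set psi : R[i] := (X in `|X|).
  have -> : psi = sandwich rho b (horner_mx (mx_homothety A s mu) (P K)).
    by rewrite -horner_mx_homothety.
  rewrite (_ : (M0 + N * (e / 3))%:C = `|F s0 m0| + (N * (e / 3))%:C); last first.
    by rewrite rmorphD M0E.
  rewrite -[X in `|X|](subKr (F s mu)).
  rewrite (le_trans (ler_normB _ _)) // lerD ?Fmax //.
  exact: h3.
rewrite -lecR -xE.
have -> : D = (sandwich (d^t*) b (mxfun (expt t) A) - sandwich (d^t*) b (horner_mx A T))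
  - (sandwich (dh^t*) bh (mxfun (expt t) Ah) - sandwich (dh^t*) bh (horner_mx Ah T))
  + sandwich_horner A rho b ((vp * T) %/ chiA).
  by rewrite -errE /D /sandwich; ring.
rewrite (le_trans (ler_normD _ _)) // (le_trans (lerD (ler_normB _ _) (lexx _))) //.
rewrite (le_trans (lerD (lerD h1 h2) dd)) // -!rmorphD lecR.
rewrite le_eqVlt; apply/orP; left; apply/eqP.
by field; rewrite gt_eqF.
Qed.
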